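(* Let $f$ be a real-valued function on pairs $(\rho,\sigma)$ with $\sigma\in\mathcal F$ and $\rho$ a density matrix on the same Hilbert space as $\sigma$, such that $f$ is locally monotonic with respect to $\mathcal C_{\mathcal F}$ and $\rho\mapsto f(\rho,\sigma)$ is continuous for each fixed $\sigma\in\mathcal F$. Then there are constants $a,b$ such that $f(\rho,\sigma)=a\,S(\rho\|\sigma)+b$ for all such pairs.
   Context: $S(\rho\|\sigma)=\mathrm{Tr}(\rho(\log\rho-\log\sigma))$. $\mathcal F$ is the set of all full-rank density matrices on finite-dimensional Hilbert spaces, and $\mathcal C_{\mathcal F}$ is the set of quantum channels (between possibly different finite-dimensional Hilbert spaces) that map full-rank states to full-rank states. $f$ is locally monotonic with respect to $\mathcal C_{\mathcal F}$ if whenever $C\in\mathcal C_{\mathcal F}$ acts on $\mathcal H_1\otimes\mathcal H_2$ with output space $\mathcal H'_1\otimes\mathcal H'_2$, $\sigma_1\otimes\sigma_2\in\mathcal F$ and $C[\sigma_1\otimes\sigma_2]=\sigma'_1\otimes\sigma'_2\in\mathcal F$, then for all density matrices $\rho_1,\rho_2$ on $\mathcal H_1,\mathcal H_2$: $f(\rho_1,\sigma_1)+f(\rho_2,\sigma_2)\ge f(\rho'_1,\sigma'_1)+f(\rho'_2,\sigma'_2)$, where $\rho'_1=\mathrm{Tr}_2[C(\rho_1\otimes\rho_2)]$ and $\rho'_2=\mathrm{Tr}_1[C(\rho_1\otimes\rho_2)]$. *)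

(* Defs.v *)
From HB Require Import structures.
From mathcomp Require Import all_boot all_order all_algebra.
From mathcomp Require Import spectral sesquilinear.
From mathcomp.real_closed Require Import complex mxtens.
From mathcomp Require Import reals exp.

Set Implicit Arguments.
Unset Strict Implicit.
Unset Printing Implicit Defensive.

Import Order.TTheory GRing.Theory Num.Theory.
Local Open Scope ring_scope.

Section Quantum.
Variable R : realType.
Local Notation C := (R[i]).

Definition adjmx m n (A : 'M[C]_(m, n)) : 'M[C]_(n, m) := (map_mx Num.conj A)^T.

Definition psd n (A : 'M[C]_n) : Prop :=
  adjmx A = A /\ forall v : 'rV[C]_n, 0 <= (v *m A *m adjmx v) 0 0.

Definition density n (A : 'M[C]_n) : Prop := psd A /\ \tr A = 1.

Definition full_rank_state n (A : 'M[C]_n) : Prop :=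
  density A /\ A \in unitmx.

(* holomorphic-free functional calculus for normal (here Hermitian)
   matrices, via the spectral decomposition A = P^-1 diag(d) P *)
Definition mxfun (g : C -> C) n (A : 'M[C]_n) : 'M[C]_n :=
  invmx (spectralmx A) *m diag_mx (map_mx g (spectral_diag A)) *m spectralmx A.

(* matrix logarithm (applied to real eigenvalues); for zero eigenvalues the
   value is irrelevant in Tr(rho log rho) since it is multiplied by 0 *)
Definition mxlog n (A : 'M[C]_n) : 'M[C]_n :=
  mxfun (fun z => (ln (complex.Re z))%:C%C) A.

Definition rel_entropy n (rho sigma : 'M[C]_n) : R :=
  complex.Re (\tr (rho *m (mxlog rho - mxlog sigma))).

Definition ptrace2 n1 n2 (X : 'M[C]_(n1 * n2)) : 'M[C]_n1 :=
  \matrix_(i, j) \sum_(k < n2) X (mxtens_index (i, k)) (mxtens_index (j, k)).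
Definition ptrace1 n1 n2 (X : 'M[C]_(n1 * n2)) : 'M[C]_n2 :=
  \matrix_(i, j) \sum_(k < n1) X (mxtens_index (k, i)) (mxtens_index (k, j)).

Definition ampliate k n m (Phi : 'M[C]_n -> 'M[C]_m) (X : 'M[C]_(k * n))
  : 'M[C]_(k * m) :=
  \sum_(a < k) \sum_(b < k)
     tensmx (delta_mx a b : 'M[C]_k)
       (Phi (\matrix_(i, j) X (mxtens_index (a, i)) (mxtens_index (b, j)))).

Definition channel n m (Phi : 'M[C]_n -> 'M[C]_m) : Prop :=
  [/\ forall (c : C) (A B : 'M[C]_n), Phi (c *: A + B) = c *: Phi A + Phi B,
      forall k (X : 'M[C]_(k * n)), psd X -> psd (ampliate Phi X)
    & forall A, \tr (Phi A) = \tr A].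

Definition channel_F n m (Phi : 'M[C]_n -> 'M[C]_m) : Prop :=
  channel Phi /\ forall A, full_rank_state A -> full_rank_state (Phi A).

Definition Ffun := forall n, 'M[C]_n -> 'M[C]_n -> R.

Definition locally_monotonic (f : Ffun) : Prop :=
  forall n1 n2 m1 m2 (Phi : 'M[C]_(n1 * n2) -> 'M[C]_(m1 * m2))
         (s1 : 'M[C]_n1) (s2 : 'M[C]_n2) (s1' : 'M[C]_m1) (s2' : 'M[C]_m2),
    channel_F Phi ->
    full_rank_state s1 -> full_rank_state s2 ->
    full_rank_state s1' -> full_rank_state s2' ->
    Phi (tensmx s1 s2) = tensmx s1' s2' ->
    forall (r1 : 'M[C]_n1) (r2 : 'M[C]_n2), density r1 -> density r2 ->
      f _ (ptrace2 (Phi (tensmx r1 r2))) s1' + f _ (ptrace1 (Phi (tensmx r1 r2))) s2'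
      <= f _ r1 s1 + f _ r2 s2.

(* continuity of a function on the set of density matrices of dimension n
   (entrywise distance; all norms are equivalent in finite dimension) *)
Definition continuous_on_states n (g : 'M[C]_n -> R) : Prop :=
  forall rho, density rho -> forall eps : R, 0 < eps ->
    exists2 delta : R, 0 < delta &
      forall rho', density rho' ->
        (forall i j, `|rho' i j - rho i j| < delta%:C%C) ->
        `|g rho' - g rho| < eps.

End Quantum.

(* Main.v *)
Require Import Defs.
From HB Require Import structures.
From mathcomp Require Import all_boot all_order all_algebra.
From mathcomp.real_closed Require Import complex.
From mathcomp Require Import reals.
From mathcomp Require Import spectral sesquilinear.
From mathcomp.real_closed Require Import mxtens.
From mathcomp Require Import sequences exp ring lra.
Set Implicit Arguments.
Unset Strict Implicit.
Unset Printing Implicit Defensive.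
Import Order.TTheory GRing.Theory Num.Theory.
Local Open Scope ring_scope.

(* Put g = f - b, where b is the value of f on one-dimensional systems. Local monotonicity
   makes g nonnegative, monotone under channels preserving full rank, subadditive on product
   pairs, and superadditive: g(X, s1 (x) s2) >= g(tr_2 X, s1) + g(tr_1 X, s2).

   For states rho, sigma and large k there are projectors P and Q, typical for rho^k with
   respect to the spectral bases of rho^k and sigma^k. Then Q P Q is a test accepting rho^k
   with probability near 1 and sigma^k with probability about exp(-k S(rho||sigma)), while
   Q P rho^k P Q is close to rho^k and bounded by about exp(k S(rho||sigma)) sigma^k.
   Testing k copies of one pair and preparing this smoothed state of l copies of another pair
   (or, on rejection, the state making the second components match exactly) is therefore
   possible as soon as k S(rho1||sigma1) > l S(rho2||sigma2) asymptotically. With the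
   properties of g and continuity in the first argument this gives k g1 >= l g2, so
   g(rho, sigma) / S(rho||sigma) does not depend on the pair. *)

(** * Positive matrices and spectral data *)

Section Psd.
Variable R : realType.
Local Notation C := (R[i]).

Lemma adjmxE m n (A : 'M[C]_(m, n)) i j : adjmx A i j = Num.conj (A j i).
Proof. by rewrite !mxE. Qed.

Lemma adjmxK m n (A : 'M[C]_(m, n)) : adjmx (adjmx A) = A.
Proof. by apply/matrixP=> i j; rewrite !adjmxE conjCK. Qed.

Lemma adjmxD m n (A B : 'M[C]_(m, n)) : adjmx (A + B) = adjmx A + adjmx B.
Proof. by apply/matrixP=> i j; rewrite !mxE rmorphD. Qed.

Lemma adjmxB m n (A B : 'M[C]_(m, n)) : adjmx (A - B) = adjmx A - adjmx B.
Proof. by apply/matrixP=> i j; rewrite !mxE rmorphB. Qed.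

Lemma adjmxZ m n (c : C) (A : 'M[C]_(m, n)) : adjmx (c *: A) = Num.conj c *: adjmx A.
Proof. by apply/matrixP=> i j; rewrite !mxE rmorphM. Qed.

Lemma adjmxM m n p (A : 'M[C]_(m, n)) (B : 'M[C]_(n, p)) :
  adjmx (A *m B) = adjmx B *m adjmx A.
Proof. by rewrite /adjmx map_mxM trmx_mul. Qed.

Lemma adjmx1 n : adjmx (1%:M : 'M[C]_n) = 1%:M.
Proof. by rewrite /adjmx map_mx1 trmx1. Qed.

Lemma adjmx_tens m n p q (A : 'M[C]_(m, n)) (B : 'M[C]_(p, q)) :
  adjmx (tensmx A B) = tensmx (adjmx A) (adjmx B).
Proof. by apply/matrixP=> i j; rewrite !mxE rmorphM. Qed.

Lemma mx11_gram n (v : 'rV[C]_n) : 0 <= (v *m adjmx v) 0 0.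
Proof.
by rewrite mxE; apply: sumr_ge0 => i _; rewrite adjmxE mul_conjC_ge0.
Qed.

Lemma gram_eq0 n (v : 'rV[C]_n) : (v *m adjmx v) 0 0 = 0 -> v = 0.
Proof.
rewrite mxE => h; apply/rowP => i; rewrite mxE.
have nn (j : 'I_n) : true -> 0 <= v 0 j * adjmx v j 0 by rewrite adjmxE mul_conjC_ge0.
have := psumr_eq0P nn h; move/(_ i isT)/eqP.
by rewrite adjmxE mul_conjC_eq0 => /eqP.
Qed.

Lemma psd_gram m n (K : 'M[C]_(m, n)) : psd (K *m adjmx K).
Proof.
split; first by rewrite adjmxM adjmxK.
by move=> v; rewrite mulmxA -[_ *m adjmx v]mulmxA -adjmxM mx11_gram.
Qed.

Lemma psd_congr m n (M : 'M[C]_(m, n)) A : psd A -> psd (M *m A *m adjmx M).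
Proof.
move=> [hA pA]; split; first by rewrite !adjmxM adjmxK hA mulmxA.
move=> v; have := pA (v *m M); congr (_ <= _).
by rewrite adjmxM !mulmxA.
Qed.

Lemma psdD n (A B : 'M[C]_n) : psd A -> psd B -> psd (A + B).
Proof.
move=> [hA pA] [hB pB]; split; first by rewrite adjmxD hA hB.
by move=> v; rewrite mulmxDr mulmxDl mxE addr_ge0.
Qed.

Lemma psdZ n (c : C) (A : 'M[C]_n) : 0 <= c -> psd A -> psd (c *: A).
Proof.
move=> c0 [hA pA]; split; first by rewrite adjmxZ hA (CrealP (ger0_real c0)).
by move=> v; rewrite -scalemxAr -scalemxAl mxE mulr_ge0.
Qed.

Lemma psd0 n : psd (0 : 'M[C]_n).
Proof. by rewrite -(scale0r 1%:M); apply: psdZ => //; rewrite -[1%:M]mulmx1 -{2}adjmx1; apply: psd_gram. Qed.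

Lemma psd1 n : psd (1%:M : 'M[C]_n).
Proof. by rewrite -[1%:M]mulmx1 -{2}adjmx1; apply: psd_gram. Qed.

Lemma psd_le_trans n (A B D : 'M[C]_n) : psd (B - A) -> psd (D - B) -> psd (D - A).
Proof. by move=> h1 h2; have := psdD h1 h2; rewrite addrC addrA subrK. Qed.

Lemma psd_diag_ge0 n (A : 'M[C]_n) i : psd A -> 0 <= A i i.
Proof.
move=> [_ /(_ (delta_mx 0 i))]; congr (_ <= _).
rewrite -rowE mxE (bigD1 i) //= big1 ?addr0 => [|j nj].
  by rewrite adjmxE !mxE !eqxx conjC1 mulr1.
by rewrite adjmxE !mxE eqxx (negPf nj) conjC0 mulr0.
Qed.

Lemma psd_tr_ge0 n (A : 'M[C]_n) : psd A -> 0 <= \tr A.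
Proof. by move=> pA; apply: sumr_ge0 => i _; apply: psd_diag_ge0. Qed.

(** * Unitaries and matrices diagonal in a given orthonormal basis *)

Definition unitary n (U : 'M[C]_n) := U *m adjmx U = 1%:M.

Lemma unitary_adjK n (U : 'M[C]_n) : unitary U -> adjmx U *m U = 1%:M.
Proof. exact: mulmx1C. Qed.

(** The adjoint stands on the left, as for [spectralmx], so the rows of a unitary [U] are left
    eigenvectors. Eigenvalues live in [R], where order and [ln] apply directly. *)
Definition sd n (U : 'M[C]_n) (d : 'I_n -> R) : 'M[C]_n :=
  adjmx U *m diag_mx (\row_i ((d i)%:C)%C) *m U.

Lemma conjCR (x : R) : Num.conj (x%:C)%C = (x%:C)%C :> C.
Proof. by apply/CrealP; rewrite complex_real. Qed.

Lemma adjmx_diag n (d : 'I_n -> R) :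
  adjmx (diag_mx (\row_i ((d i)%:C)%C)) = diag_mx (\row_i ((d i)%:C)%C) :> 'M[C]_n.
Proof.
apply/matrixP=> i j; rewrite !mxE [j == i]eq_sym.
by case: eqP => [->|_]; rewrite ?mulr1n ?mulr0n ?conjCR ?conjC0.
Qed.

Lemma adjmx_sd n (U : 'M[C]_n) d : adjmx (sd U d) = sd U d.
Proof. by rewrite /sd !adjmxM adjmxK adjmx_diag mulmxA. Qed.

Lemma sdM n (U : 'M[C]_n) d e : unitary U ->
  sd U d *m sd U e = sd U (fun i => d i * e i).
Proof.
move=> uU; rewrite /sd !mulmxA -[_ *m U *m adjmx U]mulmxA uU mulmx1.
congr (_ *m _); rewrite -!mulmxA mulmx_diag; congr (_ *m diag_mx _).
by apply/rowP=> i; rewrite !mxE rmorphM.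
Qed.

Lemma sdB n (U : 'M[C]_n) d e : sd U d - sd U e = sd U (fun i => d i - e i).
Proof.
rewrite /sd -mulmxBl -mulmxBr; congr (_ *m _ *m _).
by apply/matrixP=> i j; rewrite !mxE -mulrnBl rmorphB.
Qed.

Lemma sdZ n (U : 'M[C]_n) d (c : R) : (c%:C)%C *: sd U d = sd U (fun i => c * d i).
Proof.
rewrite /sd scalemxAl scalemxAr; congr (_ *m _ *m _).
by apply/matrixP=> i j; rewrite !mxE mulrnAr rmorphM.
Qed.

Lemma sd1 n (U : 'M[C]_n) : unitary U -> sd U (fun=> 1) = 1%:M.
Proof.
move=> uU; rewrite /sd.
have -> : diag_mx (\row__ ((1 : R)%:C)%C) = 1%:M :> 'M[C]_n.
  by apply/matrixP=> i j; rewrite !mxE.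
by rewrite mulmx1 unitary_adjK.
Qed.

Lemma sd_ext n (U : 'M[C]_n) d e : d =1 e -> sd U d = sd U e.
Proof. by move=> h; rewrite /sd; congr (_ *m diag_mx _ *m _); apply/rowP=> i; rewrite !mxE h. Qed.

Lemma sd_gram n (U : 'M[C]_n) d : (forall i, 0 <= d i) ->
  exists L : 'M[C]_n, sd U d = L *m adjmx L.
Proof.
move=> d0; exists (adjmx U *m diag_mx (\row_i ((Num.sqrt (d i))%:C)%C)).
rewrite adjmxM adjmxK adjmx_diag /sd !mulmxA; congr (_ *m _).
rewrite -mulmxA mulmx_diag; congr (_ *m diag_mx _).
by apply/rowP=> i; rewrite !mxE -rmorphM -expr2 sqr_sqrtr.
Qed.

Lemma psd_sd n (U : 'M[C]_n) d : (forall i, 0 <= d i) -> psd (sd U d).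
Proof. by move=> /(sd_gram U) [L ->]; apply: psd_gram. Qed.

Lemma tr_mul_sd n (X : 'M[C]_n) U d :
  \tr (X *m sd U d) = \sum_i (U *m X *m adjmx U) i i * ((d i)%:C)%C.
Proof.
rewrite /sd !mulmxA mxtrace_mulC !mulmxA; apply: eq_bigr => i _.
rewrite mxE (bigD1 i) //= big1 ?addr0 => [|j /negPf nj].
  by rewrite !mxE eqxx.
by rewrite [X in _ * X]mxE nj mulr0n mulr0.
Qed.

Lemma tr_sd n (U : 'M[C]_n) d : unitary U -> \tr (sd U d) = \sum_i ((d i)%:C)%C.
Proof.
move=> uU; rewrite -[sd U d]mul1mx tr_mul_sd mulmx1 uU.
by apply: eq_bigr => i _; rewrite mxE eqxx mul1r.
Qed.

Lemma sd_diag n (U : 'M[C]_n) d i : unitary U ->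
  (U *m sd U d *m adjmx U) i i = ((d i)%:C)%C.
Proof.
move=> uU; rewrite /sd !mulmxA uU mul1mx -mulmxA uU mulmx1.
by rewrite !mxE eqxx mulr1n.
Qed.

Lemma psd_spectral n (A : 'M[C]_n) : psd A ->
  let d i := complex.Re (spectral_diag A 0 i) in
  [/\ unitary (spectralmx A), forall i, 0 <= d i & A = sd (spectralmx A) d].
Proof.
move=> [hA pA] d.
have adjE m p (M : 'M[C]_(m, p)) : adjmx M = map_mx Num.conj M^T.
  by apply/matrixP=> i j; rewrite !mxE.
have hh : A \is hermsymmx.
  by apply/is_hermitianmxP; rewrite expr0 scale1r -adjE hA.
have uU : unitary (spectralmx A).
  by rewrite /unitary adjE; apply/unitarymxP/spectral_unitarymx.
have dE i : (spectral_diag A) 0 i = ((d i)%:C)%C.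
  apply/esym/RRe_real; have /mxOverP := hermitian_spectral_diag_real hh; exact.
have AE : A = sd (spectralmx A) d.
  have /orthomx_spectralP := hermitian_normalmx hh.
  rewrite (invmx_unitary (spectral_unitarymx A)) -adjE => {1}->.
  by rewrite /sd; congr (_ *m diag_mx _ *m _); apply/rowP=> i; rewrite mxE dE.
split=> // i.
have := psd_diag_ge0 i (psd_congr (spectralmx A) (conj hA pA)).
by rewrite {2}AE (sd_diag _ _ uU) ler0c.
Qed.

Lemma psd_root n (A : 'M[C]_n) : psd A -> exists L : 'M[C]_n, A = L *m adjmx L.
Proof. by move=> /psd_spectral [_ d0 ->]; apply: sd_gram. Qed.

Lemma psd_trM_ge0 n (A B : 'M[C]_n) : psd A -> psd B -> 0 <= \tr (A *m B).
Proof.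
move=> /psd_root [L ->] pB; rewrite -mulmxA mxtrace_mulC.
by have := psd_tr_ge0 (psd_congr (adjmx L) pB); rewrite adjmxK.
Qed.

Lemma psd_trM_le n (A B D : 'M[C]_n) : psd A -> psd (D - B) -> \tr (A *m B) <= \tr (A *m D).
Proof. by move=> pA /(psd_trM_ge0 pA); rewrite mulmxBr raddfB subr_ge0. Qed.

(** Squared Hilbert-Schmidt norm. It is also the trace of [K *m adjmx K], so probabilities become
    norms of Gram factors. *)
Definition hs m n (K : 'M[C]_(m, n)) : C := \tr (K *m adjmx K).

Lemma hs_ge0 m n (K : 'M[C]_(m, n)) : 0 <= hs K.
Proof. exact/psd_tr_ge0/psd_gram. Qed.

Lemma hsE m n (K : 'M[C]_(m, n)) : hs K = \sum_i \sum_j `|K i j| ^+ 2.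
Proof.
apply: eq_bigr => i _; rewrite mxE; apply: eq_bigr => j _.
by rewrite adjmxE normCK.
Qed.

Lemma hsN m n (K : 'M[C]_(m, n)) : hs (- K) = hs K.
Proof. by rewrite !hsE; apply: eq_bigr => i _; apply: eq_bigr => j _; rewrite mxE normrN. Qed.

(** Parallelogram law, with [hs (K - L)] dropped. *)
Lemma hsD m n (K L : 'M[C]_(m, n)) : hs (K + L) <= 2 * (hs K + hs L).
Proof.
have -> : 2 * (hs K + hs L) = hs (K + L) + hs (K - L).
  rewrite /hs !(adjmxB, adjmxD) !(mulmxBl, mulmxBr, mulmxDl, mulmxDr, raddfB) /=.
  rewrite !(raddfB, raddfD) /=; ring.
by rewrite lerDl hs_ge0.
Qed.

Lemma hsB m n (K L : 'M[C]_(m, n)) : hs (K - L) <= 2 * (hs K + hs L).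
Proof. by have := hsD K (- L); rewrite hsN. Qed.

Lemma hs_mulr_le m n p (M : 'M[C]_(m, n)) (K : 'M[C]_(n, p)) :
  psd (1%:M - adjmx M *m M) -> hs (M *m K) <= hs K.
Proof.
move=> h; rewrite /hs adjmxM -[M *m K *m _]mulmxA mxtrace_mulC !mulmxA.
rewrite -[_ *m adjmx M *m M]mulmxA -{2}[K *m adjmx K]mulmx1.
exact: psd_trM_le (psd_gram _) h.
Qed.

End Psd.

(** * Kraus maps and partial traces *)

Section Channels.
Variable R : realType.
Local Notation C := (R[i]).

Lemma sum_mxtens (V : nmodType) m n (F : 'I_(m * n) -> V) :
  \sum_i F i = \sum_(i < m) \sum_(j < n) F (mxtens_index (i, j)).
Proof.
rewrite pair_big (reindex (@mxtens_index m n)) /=; last first.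
  by exists (@mxtens_unindex m n) => i _; rewrite ?mxtens_indexK ?mxtens_unindexK.
by apply: eq_bigr => -[i j] _.
Qed.

(** Kraus form is closed under sums and composition and gives complete positivity at once. *)
Definition kraus m n (Phi : 'M[C]_n -> 'M[C]_m) :=
  exists s : seq 'M[C]_(m, n), forall X, Phi X = \sum_(K <- s) K *m X *m adjmx K.

Lemma id_mxE n (i j : 'I_n) : (1%:M : 'M[C]_n) i j = (i == j)%:R.
Proof. by rewrite mxE. Qed.

(** Ampliating a single Kraus term [K] amounts to conjugating by [tensmx 1%:M K]; this is the
    blockwise computation. *)
Lemma tensmx1_conj_block k m n (K : 'M[C]_(m, n)) (X : 'M[C]_(k * n)) a i b j :
  (tensmx 1%:M K *m X *m adjmx (tensmx 1%:M K)) (mxtens_index (a, i)) (mxtens_index (b, j)) =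
  (K *m (\matrix_(i, j) X (mxtens_index (a, i)) (mxtens_index (b, j))) *m adjmx K) i j.
Proof.
rewrite mxE sum_mxtens (bigD1 b) //= [X in _ + X]big1 ?addr0; last first.
  move=> c /negPf nc; apply: big1 => y _.
  by rewrite adjmxE tensmxE id_mxE eq_sym nc mul0r conjC0 mulr0.
rewrite [RHS]mxE; apply: eq_bigr => y _; rewrite !adjmxE tensmxE id_mxE eqxx mul1r.
congr (_ * _); rewrite !mxE sum_mxtens (bigD1 a) //= [X in _ + X]big1 ?addr0; last first.
  by move=> c /negPf nc; apply: big1 => x _; rewrite tensmxE id_mxE eq_sym nc mul0r mul0r.
by apply: eq_bigr => x _; rewrite tensmxE id_mxE eqxx mul1r mxE.
Qed.

Lemma ampliateE k n m (Phi : 'M[C]_n -> 'M[C]_m) (X : 'M[C]_(k * n)) a i b j :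
  ampliate Phi X (mxtens_index (a, i)) (mxtens_index (b, j)) =
  Phi (\matrix_(i, j) X (mxtens_index (a, i)) (mxtens_index (b, j))) i j.
Proof.
rewrite /ampliate summxE (bigD1 a) //= [X in _ + X]big1 ?addr0; last first.
  move=> c /negPf nc; rewrite summxE big1 // => d _.
  by rewrite tensmxE mxE eq_sym nc mul0r.
rewrite summxE (bigD1 b) //= [X in _ + X]big1 ?addr0; last first.
  by move=> c /negPf nc; rewrite tensmxE mxE [b == c]eq_sym nc andbF mul0r.
by rewrite tensmxE mxE !eqxx mul1r.
Qed.

Lemma kraus_psd_ampliate m n (Phi : 'M[C]_n -> 'M[C]_m) k (X : 'M[C]_(k * n)) :
  kraus Phi -> psd X -> psd (ampliate Phi X).
Proof.
move=> [s Phis] pX.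
have -> : ampliate Phi X =
    \sum_(K <- s) tensmx 1%:M K *m X *m adjmx (tensmx (1%:M : 'M_k) K).
  apply/matrixP=> u v; case: (mxtens_indexP u) => a i; case: (mxtens_indexP v) => b j.
  rewrite ampliateE Phis !summxE; apply: eq_bigr => K _.
  by rewrite tensmx1_conj_block.
elim: s {Phis} => [|K s IH]; first by rewrite big_nil; apply: psd0.
by rewrite big_cons; apply: psdD IH; apply: psd_congr.
Qed.

Lemma kraus_psd m n (Phi : 'M[C]_n -> 'M[C]_m) X : kraus Phi -> psd X -> psd (Phi X).
Proof.
move=> [s ->] pX; elim: s => [|K s IH]; first by rewrite big_nil; apply: psd0.
by rewrite big_cons; apply: psdD IH; apply: psd_congr.
Qed.

Lemma kraus_linear m n (Phi : 'M[C]_n -> 'M[C]_m) (c : C) A B : kraus Phi ->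
  Phi (c *: A + B) = c *: Phi A + Phi B.
Proof.
move=> [s Phis]; rewrite !Phis scaler_sumr -big_split; apply: eq_bigr => K _ /=.
by rewrite mulmxDr mulmxDl -scalemxAr -scalemxAl.
Qed.

Lemma kraus_comp m n p (Phi : 'M[C]_n -> 'M[C]_m) (Psi : 'M[C]_p -> 'M[C]_n) :
  kraus Phi -> kraus Psi -> kraus (fun X => Phi (Psi X)).
Proof.
move=> [s Phis] [t Psit]; exists [seq K *m L | K <- s, L <- t] => X.
rewrite Phis big_allpairs_dep; apply: eq_bigr => K _.
rewrite Psit mulmx_sumr mulmx_suml; apply: eq_bigr => L _.
by rewrite adjmxM !mulmxA.
Qed.

Lemma krausD m n (Phi Psi : 'M[C]_n -> 'M[C]_m) :
  kraus Phi -> kraus Psi -> kraus (fun X => Phi X + Psi X).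
Proof. by move=> [s Phis] [t Psit]; exists (s ++ t) => X; rewrite Phis Psit big_cat. Qed.

Lemma delta_conj m n (X : 'M[C]_n) (i : 'I_m) j :
  delta_mx i j *m X *m delta_mx j i = X j j *: delta_mx i i.
Proof.
apply/matrixP=> u v; rewrite !mxE (bigD1 j) //= big1 ?addr0; last first.
  by move=> k /negPf nk; rewrite !mxE nk mulr0.
rewrite !mxE (bigD1 j) //= big1 ?addr0; last first.
  by move=> k /negPf nk; rewrite !mxE nk andbF mul0r.
rewrite !mxE !eqxx /= andbT; case: (u == i); case: (v == i);
  by rewrite ?(mul1r, mulr1, mul0r, mulr0).
Qed.

Lemma adjmx_delta m n (i : 'I_m) (j : 'I_n) : adjmx (delta_mx i j) = delta_mx j i :> 'M[C]__.
Proof. by apply/matrixP=> u v; rewrite !mxE andbC; case: (_ && _); rewrite ?conjC0 ?conjC1. Qed.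

(** With [Q] and [L] the Gram factors of [T] and [A], the Kraus operators are
    [L *m delta_mx i j *m adjmx Q]. *)
Lemma kraus_measure_prepare m n (T : 'M[C]_n) (A : 'M[C]_m) :
  psd T -> psd A -> kraus (fun X => \tr (T *m X) *: A).
Proof.
move=> /psd_root [Q ->] /psd_root [L ->].
exists [seq L *m delta_mx i j *m adjmx Q | i <- enum 'I_m, j <- enum 'I_n] => X.
rewrite big_allpairs_dep big_enum /=.
under eq_bigr => i _.
  rewrite big_enum /=.
  under eq_bigr => j _.
    rewrite !adjmxM adjmxK adjmx_delta.
    have -> : L *m delta_mx i j *m adjmx Q *m X *m (Q *m (delta_mx j i *m adjmx L)) =
      L *m (delta_mx i j *m (adjmx Q *m X *m Q) *m delta_mx j i) *m adjmx L.
      by rewrite !mulmxA.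
    rewrite delta_conj -scalemxAr -scalemxAl; over.
  rewrite -scaler_suml; over.
rewrite -scaler_sumr; congr (_ *: _).
  by rewrite -mulmxA mxtrace_mulC.
rewrite -mulmx_suml -mulmx_sumr; congr (_ *m _).
rewrite -[LHS]mulmx1; congr (_ *m _); apply/matrixP=> u v.
rewrite summxE (bigD1 u) //= big1 ?addr0 => [|k /negPf nk]; rewrite !mxE.
  by rewrite eqxx eq_sym.
by rewrite eq_sym nk.
Qed.

Lemma psd_unit_faithful n (A : 'M[C]_n) (v : 'rV[C]_n) : psd A -> A \in unitmx ->
  (v *m A *m adjmx v) 0 0 = 0 -> v = 0.
Proof.
move=> /psd_root [L ->] uA h.
have vL : v *m L = 0 by apply: gram_eq0; rewrite adjmxM !mulmxA -[v *m L *m _]mulmxA.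
by rewrite -[v](mulmxK uA) mulmxA vL !mul0mx.
Qed.

(** A row vector in the kernel of [B] has nonpositive expectation in [A], hence vanishes because [A]
    is faithful. *)
Lemma dominating_unit n (A B : 'M[C]_n) (c : C) : psd A -> A \in unitmx -> 0 < c ->
  psd (B - c *: A) -> B \in unitmx.
Proof.
move=> pA uA c0 [_ pB]; rewrite -row_free_unit -kermx_eq0; apply/eqP/row_matrixP => i.
rewrite row0; apply: (psd_unit_faithful pA uA); set v := row _ _.
have vB : v *m B = 0 by rewrite -row_mul mulmx_ker row0.
have := pB v; rewrite mulmxBr vB sub0r -scalemxAr mulNmx -scalemxAl 2!mxE oppr_ge0.
rewrite pmulr_rle0 // => h; apply/eqP; rewrite eq_le h.
by have [_ /(_ v)] := pA.
Qed.

Lemma full_rank_ge_scalar n (A : 'M[C]_n) : psd A -> A \in unitmx ->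
  exists2 c : R, 0 < c & psd (A - (c%:C)%C *: 1%:M).
Proof.
move=> pA uA; have [uU d0 AE] := psd_spectral pA.
set U := spectralmx A in uU AE; set d := (fun i => _) in d0 AE.
have dpos i : 0 < d i.
  rewrite lt_neqAle d0 andbT eq_sym; apply/eqP => di.
  (* A zero eigenvalue would give row [i] of [U] expectation 0 in [A]; the row would vanish, against
     unitarity. *)
  have rU : row i U = 0.
    apply: (psd_unit_faithful pA uA); rewrite AE /sd !mulmxA -row_mul uU row1 -rowE.
    rewrite -mulmxA mxE big1 // => k _.
    rewrite [X in X * _](_ : _ = 0) ?mul0r // !mxE di.
    by case: eqP; rewrite ?mulr0n ?mulr1n.
  have : (U *m adjmx U) i i = 0.
    have -> : (U *m adjmx U) i i = (row i U *m adjmx U) 0 i by rewrite -row_mul [RHS]mxE.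
    by rewrite rU mul0mx mxE.
  by rewrite uU mxE eqxx => /eqP; rewrite oner_eq0.
(* The least eigenvalue, capped at 1; the cap also covers [n = 0]. *)
exists (\big[Order.min/1]_i d i).
  by elim/big_ind: _ => // [x y x0 y0]; rewrite lt_min x0.
rewrite -(sd1 uU) {1}AE sdZ sdB; apply: psd_sd => i.
by rewrite mulr1 subr_ge0; apply: bigmin_le_cond.
Qed.

(** A sufficient form of [channel_F] that composes easily: Kraus form replaces complete positivity,
    and invertibility is asked of all positive matrices, so nothing needs normalizing. *)
Definition faithful_channel m n (Phi : 'M[C]_n -> 'M[C]_m) :=
  [/\ kraus Phi, forall A, \tr (Phi A) = \tr A
    & forall A, psd A -> A \in unitmx -> Phi A \in unitmx].

Lemma faithful_channelP m n (Phi : 'M[C]_n -> 'M[C]_m) :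
  faithful_channel Phi -> channel_F Phi.
Proof.
move=> [kP tP uP]; split; first split=> //.
- by move=> c A B; apply: kraus_linear.
- by move=> k X; apply: kraus_psd_ampliate.
move=> A [[pA tA] uA]; split; last exact: uP.
by split; [apply: kraus_psd | rewrite tP].
Qed.

Lemma faithful_channel_comp m n p (Phi : 'M[C]_n -> 'M[C]_m) (Psi : 'M[C]_p -> 'M[C]_n) :
  faithful_channel Phi -> faithful_channel Psi -> faithful_channel (fun X => Phi (Psi X)).
Proof.
move=> [k1 t1 u1] [k2 t2 u2]; split; first exact: kraus_comp.
  by move=> A; rewrite t1 t2.
by move=> A pA uA; apply: u1; [apply: kraus_psd | apply: u2].
Qed.

Lemma faithful_channel_unitary m n (K : 'M[C]_(m, n)) :
  K *m adjmx K = 1%:M -> adjmx K *m K = 1%:M ->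
  faithful_channel (fun X => K *m X *m adjmx K).
Proof.
move=> K1 K2; split.
- by exists [:: K] => X; rewrite big_seq1.
- by move=> A; rewrite mxtrace_mulC mulmxA K2 mul1mx.
move=> A pA uA.
suff: (K *m A *m adjmx K) *m (K *m invmx A *m adjmx K) = 1%:M by case/mulmx1_unit.
rewrite !mulmxA -[_ *m adjmx K *m K]mulmxA K2 mulmx1 -[K *m A *m _]mulmxA.
by rewrite mulmxV // mulmx1.
Qed.

(** Identifies a system with its product with a one-dimensional one. Local monotonicity speaks of
    bipartite systems only, and [n * 1] is not convertible to [n]. *)
Definition unit_factor n : 'M[C]_(n * 1, n) :=
  \matrix_(i, j) ((mxtens_unindex i).1 == j)%:R.

Lemma unit_factorK n : adjmx (unit_factor n) *m unit_factor n = 1%:M.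
Proof.
apply/matrixP=> i j; rewrite !mxE sum_mxtens (bigD1 i) //= [X in _ + X]big1 ?addr0; last first.
  by move=> k /negPf nk; rewrite big1 // => l _; rewrite !mxE mxtens_indexK /= nk conjC0 mul0r.
by rewrite big_ord1 !mxE mxtens_indexK /= eqxx conjC1 mul1r.
Qed.

Lemma unit_factorVK n : unit_factor n *m adjmx (unit_factor n) = 1%:M.
Proof.
apply/matrixP=> u v; case: (mxtens_indexP u) => i a; case: (mxtens_indexP v) => j b.
rewrite [a]ord1 [b]ord1 !mxE (can_eq (@mxtens_indexK _ _)) xpair_eqE eqxx andbT.
rewrite (bigD1 i) //= big1 ?addr0; last first.
  by move=> k /negPf nk; rewrite !mxE mxtens_indexK /= [i == k]eq_sym nk mul0r.
by rewrite !mxE !mxtens_indexK /= eqxx mul1r eq_sym conjC_nat.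
Qed.

Lemma tens_unit_factor n (X : 'M[C]_n) :
  tensmx X (1%:M : 'M[C]_1) = unit_factor n *m X *m adjmx (unit_factor n).
Proof.
apply/matrixP=> u v; case: (mxtens_indexP u) => i a; case: (mxtens_indexP v) => j b.
rewrite tensmxE [a]ord1 [b]ord1 mxE eqxx mulr1 mxE (bigD1 j) //= big1 ?addr0; last first.
  by move=> k /negPf nk; rewrite !mxE mxtens_indexK /= eq_sym nk conjC0 mulr0.
rewrite !mxE mxtens_indexK /= eqxx conjC1 mulr1 (bigD1 i) //= big1 ?addr0; last first.
  by move=> k /negPf nk; rewrite !mxE mxtens_indexK /= eq_sym nk mul0r.
by rewrite !mxE mxtens_indexK /= eqxx mul1r.
Qed.

Lemma faithful_tens_unit n : faithful_channel (fun X : 'M[C]_n => tensmx X (1%:M : 'M[C]_1)).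
Proof.
have [[s k] t u] := faithful_channel_unitary (unit_factorVK n) (unit_factorK n).
split; first by exists s => X; rewrite tens_unit_factor.
  by move=> A; rewrite tens_unit_factor.
by move=> A; rewrite tens_unit_factor; apply: u.
Qed.

Definition strip_unit n (Y : 'M[C]_(n * 1)) : 'M[C]_n :=
  adjmx (unit_factor n) *m Y *m unit_factor n.

Lemma strip_unitK n (X : 'M[C]_n) : strip_unit (tensmx X 1%:M) = X.
Proof.
rewrite tens_unit_factor /strip_unit !mulmxA unit_factorK mul1mx.
by rewrite -mulmxA unit_factorK mulmx1.
Qed.

Lemma faithful_strip_unit n : faithful_channel (@strip_unit n).
Proof.
have := @faithful_channel_unitary _ _ (adjmx (unit_factor n)).
by rewrite adjmxK; apply; [exact: unit_factorK | exact: unit_factorVK].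
Qed.

(** * Tensor products and partial traces of states *)

Lemma mxtrace_tens m n (A : 'M[C]_m) (B : 'M[C]_n) : \tr (tensmx A B) = \tr A * \tr B.
Proof.
rewrite /mxtrace sum_mxtens mulr_suml; apply: eq_bigr => i _.
by rewrite mulr_sumr; apply: eq_bigr => j _; rewrite tensmxE.
Qed.

Lemma psd_tens m n (A : 'M[C]_m) (B : 'M[C]_n) : psd A -> psd B -> psd (tensmx A B).
Proof.
move=> /psd_root [L ->] /psd_root [K ->].
by rewrite -tensmx_mul -adjmx_tens; apply: psd_gram.
Qed.

Lemma density_tens m n (A : 'M[C]_m) (B : 'M[C]_n) :
  density A -> density B -> density (tensmx A B).
Proof. by move=> [pA tA] [pB tB]; split; [apply: psd_tens | rewrite mxtrace_tens tA tB mulr1]. Qed.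

Lemma density_dim n (A : 'M[C]_n) : density A -> n != 0%N.
Proof.
by move=> [_]; case: n A => // A; rewrite /mxtrace big_ord0 => /eqP; rewrite eq_sym oner_eq0.
Qed.

Lemma full_rank_tens m n (A : 'M[C]_m) (B : 'M[C]_n) :
  full_rank_state A -> full_rank_state B -> full_rank_state (tensmx A B).
Proof.
move=> [dA uA] [dB uB]; split; first exact: density_tens.
by apply: tensmx_unit uA uB; apply: density_dim; eassumption.
Qed.

Lemma density1 : density (1%:M : 'M[C]_1).
Proof. by split; [apply: psd1 | rewrite mxtrace1]. Qed.

Lemma full_rank1 : full_rank_state (1%:M : 'M[C]_1).
Proof. by split; [apply: density1 | apply: unitmx1]. Qed.

(* Moving the traced-out index into the column index keeps the Hilbert-Schmidt norm. *)
Definition fold1 n1 n2 p (K : 'M[C]_(n1 * n2, p)) : 'M[C]_(n2, n1 * p) :=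
  \matrix_(j, x) K (mxtens_index ((mxtens_unindex x).1, j)) (mxtens_unindex x).2.
Definition fold2 n1 n2 p (K : 'M[C]_(n1 * n2, p)) : 'M[C]_(n1, n2 * p) :=
  \matrix_(i, x) K (mxtens_index (i, (mxtens_unindex x).1)) (mxtens_unindex x).2.

(** The traced-out index joins the inner summation index. Positivity and entry bounds for marginals
    are read off from the folded factors. *)
Lemma ptrace1_gram n1 n2 p (K L : 'M[C]_(n1 * n2, p)) :
  ptrace1 (K *m adjmx L) = fold1 K *m adjmx (fold1 L).
Proof.
apply/matrixP=> i j; rewrite !mxE sum_mxtens; apply: eq_bigr => k _.
by rewrite !mxE; apply: eq_bigr => x _; rewrite !mxE mxtens_indexK.
Qed.

Lemma ptrace2_gram n1 n2 p (K L : 'M[C]_(n1 * n2, p)) :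
  ptrace2 (K *m adjmx L) = fold2 K *m adjmx (fold2 L).
Proof.
apply/matrixP=> i j; rewrite !mxE sum_mxtens; apply: eq_bigr => k _.
by rewrite !mxE; apply: eq_bigr => x _; rewrite !mxE mxtens_indexK.
Qed.

Lemma hs_fold1 n1 n2 p (K : 'M[C]_(n1 * n2, p)) : hs (fold1 K) = hs K.
Proof.
rewrite !hsE sum_mxtens [RHS]exchange_big; apply: eq_bigr => j _; rewrite sum_mxtens.
by apply: eq_bigr => i _; apply: eq_bigr => x _; rewrite mxE mxtens_indexK.
Qed.

Lemma hs_fold2 n1 n2 p (K : 'M[C]_(n1 * n2, p)) : hs (fold2 K) = hs K.
Proof.
rewrite !hsE sum_mxtens; apply: eq_bigr => j _; rewrite sum_mxtens.
by apply: eq_bigr => i _; apply: eq_bigr => x _; rewrite mxE mxtens_indexK.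
Qed.

Lemma tr_ptrace1 n1 n2 (X : 'M[C]_(n1 * n2)) : \tr (ptrace1 X) = \tr X.
Proof.
rewrite /mxtrace sum_mxtens exchange_big; apply: eq_bigr => j _ /=; by rewrite mxE.
Qed.

Lemma tr_ptrace2 n1 n2 (X : 'M[C]_(n1 * n2)) : \tr (ptrace2 X) = \tr X.
Proof. by rewrite /mxtrace sum_mxtens; apply: eq_bigr => j _ /=; rewrite mxE. Qed.

Lemma density_ptrace1 n1 n2 (X : 'M[C]_(n1 * n2)) : density X -> density (ptrace1 X).
Proof.
move=> [/psd_root [L XE] tX]; split; last by rewrite tr_ptrace1.
by rewrite XE ptrace1_gram; apply: psd_gram.
Qed.

Lemma density_ptrace2 n1 n2 (X : 'M[C]_(n1 * n2)) : density X -> density (ptrace2 X).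
Proof.
move=> [/psd_root [L XE] tX]; split; last by rewrite tr_ptrace2.
by rewrite XE ptrace2_gram; apply: psd_gram.
Qed.

Lemma ptrace1P n1 n2 c (X Y : 'M[C]_(n1 * n2)) :
  ptrace1 (c *: X + Y) = c *: ptrace1 X + ptrace1 Y.
Proof.
apply/matrixP=> i j; rewrite !mxE mulr_sumr -big_split.
by apply: eq_bigr => k _; rewrite !mxE.
Qed.

Lemma ptrace2P n1 n2 c (X Y : 'M[C]_(n1 * n2)) :
  ptrace2 (c *: X + Y) = c *: ptrace2 X + ptrace2 Y.
Proof.
apply/matrixP=> i j; rewrite !mxE mulr_sumr -big_split.
by apply: eq_bigr => k _; rewrite !mxE.
Qed.

Lemma ptrace2_tens n1 n2 (A : 'M[C]_n1) (B : 'M[C]_n2) :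
  ptrace2 (tensmx A B) = \tr B *: A.
Proof.
apply/matrixP=> i j; rewrite !mxE mulr_suml; apply: eq_bigr => k _.
by rewrite tensmxE mulrC.
Qed.

Lemma ptrace1_tens n1 n2 (A : 'M[C]_n1) (B : 'M[C]_n2) :
  ptrace1 (tensmx A B) = \tr A *: B.
Proof.
by apply/matrixP=> i j; rewrite !mxE mulr_suml; apply: eq_bigr => k _; rewrite tensmxE.
Qed.

(* AM-GM with weight [c] *)
Lemma gram_entry_le m n (c : C) (K D : 'M[C]_(m, n)) i j : 0 < c ->
  hs K <= 1 -> hs D <= c ^+ 2 ->
  `|(K *m adjmx D) i j| <= c.
Proof.
move=> c0 hK hD.
have row_le (M : 'M[C]_(m, n)) u : \sum_x `|M u x| ^+ 2 <= hs M.
  rewrite hsE (bigD1 u) //= lerDl; apply: sumr_ge0 => a _; apply: sumr_ge0 => b _.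
  by rewrite exprn_ge0.
rewrite mxE; apply: (le_trans (ler_norm_sum _ _ _)).
have amgm (x y : C) : 0 <= x -> 0 <= y -> x * y <= (c * x ^+ 2 + c^-1 * y ^+ 2) / 2.
  move=> x0 y0; rewrite ler_pdivlMr // -subr_ge0.
  have -> : c * x ^+ 2 + c^-1 * y ^+ 2 - x * y * 2 = c^-1 * (c * x - y) ^+ 2.
    by field; rewrite gt_eqF.
  by rewrite mulr_ge0 ?invr_ge0 ?(ltW c0) // real_exprn_even_ge0 // rpredB ?rpredM ?ger0_real // ltW.
apply: (@le_trans _ _ (\sum_x ((c * `|K i x| ^+ 2 + c^-1 * `|D j x| ^+ 2) / 2))).
  by apply: ler_sum => x _; rewrite adjmxE normrM norm_conjC amgm.
rewrite -mulr_suml big_split /= -!mulr_sumr ler_pdivrMr // mulrDr mulr1.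
apply: lerD; first by rewrite ler_piMr ?(ltW c0) // (le_trans (row_le _ _)).
by rewrite mulrC ler_pdivrMr // -expr2 (le_trans (row_le _ _)).
Qed.

Lemma density_entry_le n (A : 'M[C]_n) i j : density A -> `|A i j| <= 1.
Proof.
move=> [/psd_root [L ->] tA]; apply: gram_entry_le => //; rewrite ?expr1n /hs tA //.
Qed.

End Channels.

(** * Consequences of local monotonicity *)

Section LocalMonotonicity.
Variables (R : realType) (f : Ffun R).
Hypothesis fM : locally_monotonic f.
Local Notation C := (R[i]).

(** The function g of the overview; the subtracted value becomes the final constant b. *)
Definition excess n (rho sigma : 'M[C]_n) : R := f rho sigma - f (1%:M : 'M[C]_1) 1%:M.

(** Local monotonicity for the channel that strips a trivial second factor, applies [Phi] and
    appends a trivial factor; the two trivial terms cancel. *)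
Lemma excess_monotone m n (Phi : 'M[C]_n -> 'M[C]_m) rho sigma :
  faithful_channel Phi -> density rho -> full_rank_state sigma ->
  excess (Phi rho) (Phi sigma) <= excess rho sigma.
Proof.
move=> FPhi drho fsigma.
have [_ fPhi] := faithful_channelP FPhi.
have FPsi : channel_F (fun Y => tensmx (Phi (strip_unit Y)) (1%:M : 'M[C]_1)).
  apply: faithful_channelP; apply: (faithful_channel_comp (faithful_tens_unit R m)).
  exact: (faithful_channel_comp FPhi (faithful_strip_unit R n)).
have := fM FPsi fsigma (full_rank1 R) (fPhi _ fsigma) (full_rank1 R).
rewrite strip_unitK => /(_ erefl _ _ drho (density1 R)).
rewrite strip_unitK ptrace2_tens ptrace1_tens mxtrace1 scale1r.
have [[_ _ tPhi] _] := faithful_channelP FPhi.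
by rewrite tPhi (proj2 drho) scale1r lerD2r lerBlDr subrK.
Qed.

(** Appending a trivial factor regroups the input factors [n1], [n2] into output factors [n1 * n2]
    and 1, so two pairs are merged into one. *)
Lemma excess_subadditive n1 n2 (r1 s1 : 'M[C]_n1) (r2 s2 : 'M[C]_n2) :
  density r1 -> density r2 -> full_rank_state s1 -> full_rank_state s2 ->
  excess (tensmx r1 r2) (tensmx s1 s2) <= excess r1 s1 + excess r2 s2.
Proof.
move=> dr1 dr2 fs1 fs2.
have := fM (faithful_channelP (faithful_tens_unit R (n1 * n2))) fs1 fs2
  (full_rank_tens fs1 fs2) (full_rank1 R) erefl dr1 dr2.
rewrite ptrace2_tens ptrace1_tens mxtrace1 scale1r mxtrace_tens (proj2 dr1) (proj2 dr2).
rewrite mulr1 scale1r /excess; lra.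
Qed.

(** The opposite regrouping. Only the reference state must be a product; [X] may be correlated. *)
Lemma excess_superadditive n1 n2 (X : 'M[C]_(n1 * n2)) s1 s2 :
  density X -> full_rank_state s1 -> full_rank_state s2 ->
  excess (ptrace2 X) s1 + excess (ptrace1 X) s2 <= excess X (tensmx s1 s2).
Proof.
move=> dX fs1 fs2.
have := fM (faithful_channelP (faithful_strip_unit R (n1 * n2))) (full_rank_tens fs1 fs2)
  (full_rank1 R) fs1 fs2 (strip_unitK _) dX (density1 R).
rewrite strip_unitK /excess; lra.
Qed.

(** Monotonicity under the trace, a channel to the one-dimensional system, where [excess] is 0. *)
Lemma excess_ge0 n (rho sigma : 'M[C]_n) :
  density rho -> full_rank_state sigma -> 0 <= excess rho sigma.
Proof.
move=> drho fsigma.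
have Ftr : faithful_channel (fun X : 'M[C]_n => \tr (1%:M *m X) *: (1%:M : 'M[C]_1)).
  split; first by apply: kraus_measure_prepare; apply: psd1.
    by move=> A; rewrite mul1mx mxtraceZ mxtrace1 mulr1.
  move=> A pA uA; rewrite mul1mx unitmxZ ?unitmx1 // unitfE; apply/eqP => tA.
  have [c c0 pAc] := full_rank_ge_scalar pA uA.
  have := psd_tr_ge0 pAc; rewrite raddfB /= tA mxtraceZ mxtrace1 sub0r oppr_ge0.
  have n0 : n != 0%N := density_dim drho.
  by rewrite pmulr_rle0 ?ltcR // lern0 (negPf n0).
have := excess_monotone Ftr drho fsigma.
rewrite !mul1mx (proj2 drho) (proj2 (proj1 fsigma)) scale1r.
by rewrite /excess subrr.
Qed.

(** This is n^k; by this recursion [pdim n k.+1] unfolds to [n * pdim n k], so tensor powers need no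
    casts. *)
Fixpoint pdim n k := if k is k'.+1 then (n * pdim n k')%N else 1%N.

Fixpoint tpow n (A : 'M[C]_n) k : 'M[C]_(pdim n k) :=
  if k is k'.+1 then tensmx A (tpow A k') else 1%:M.

Fixpoint marginal n k : 'M[C]_(pdim n k) -> nat -> 'M[C]_n :=
  match k with
  | 0%N => fun _ _ => 0
  | k'.+1 => fun X i => if i is i'.+1 then marginal (ptrace1 X) i' else ptrace2 X
  end.

Lemma density_tpow n (A : 'M[C]_n) k : density A -> density (tpow A k).
Proof. by move=> dA; elim: k => [|k IH] /=; [apply: density1 | apply: density_tens]. Qed.

Lemma full_rank_tpow n (A : 'M[C]_n) k : full_rank_state A -> full_rank_state (tpow A k).
Proof. by move=> dA; elim: k => [|k IH] /=; [apply: full_rank1 | apply: full_rank_tens]. Qed.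

Lemma excess_tpow_le n (rho sigma : 'M[C]_n) k : density rho -> full_rank_state sigma ->
  excess (tpow rho k) (tpow sigma k) <= k%:R * excess rho sigma.
Proof.
move=> drho fsigma; elim: k => [|k IH] /=; first by rewrite /excess subrr mul0r.
apply: le_trans (excess_subadditive _ _ _ _) _ => //.
- exact: density_tpow.
- exact: full_rank_tpow.
by rewrite -natr1 mulrDl mul1r [X in _ <= X]addrC lerD2l.
Qed.

(** Superadditivity peels off one factor at a time, whatever the correlations in [X]; [excess_ge0]
    is the base case. *)
Lemma excess_ge_marginals n (sigma : 'M[C]_n) k (X : 'M[C]_(pdim n k)) (c : R) :
  density X -> full_rank_state sigma ->
  (forall i, (i < k)%N -> c <= excess (marginal X i) sigma) ->
  k%:R * c <= excess X (tpow sigma k).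
Proof.
move=> dX fsigma; elim: k X dX => [|k IH] X dX h /=.
  by rewrite mul0r; apply: excess_ge0 => //; apply: full_rank1.
apply: le_trans (excess_superadditive dX fsigma (full_rank_tpow k fsigma)).
rewrite -natr1 mulrDl mul1r addrC; apply: lerD; first exact: (h 0%N).
by apply: IH; [apply: density_ptrace1 | move=> i ik; apply: (h i.+1)].
Qed.

Lemma density_marginal n k (X : 'M[C]_(pdim n k)) i : density X -> (i < k)%N ->
  density (marginal X i).
Proof.
elim: k X i => [|k IH] X [|i] //= dX ik; first exact: density_ptrace2.
by apply: IH => //; apply: density_ptrace1.
Qed.

Lemma marginalP n k (c : C) (X Y : 'M[C]_(pdim n k)) i :
  marginal (c *: X + Y) i = c *: marginal X i + marginal Y i.
Proof.
elim: k X Y i => [|k IH] X Y i /=; first by rewrite scaler0 addr0.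
by case: i => [|i]; rewrite ?ptrace2P // ptrace1P IH.
Qed.

Lemma marginal0 n k i : marginal (0 : 'M[C]_(pdim n k)) i = 0.
Proof.
have := marginalP (-1) (0 : 'M[C]_(pdim n k)) 0 i.
by rewrite scaler0 addr0 scaleN1r addNr.
Qed.

Lemma marginalZ n k (c : C) (X : 'M[C]_(pdim n k)) i :
  marginal (c *: X) i = c *: marginal X i.
Proof. by rewrite -[c *: X]addr0 marginalP marginal0 addr0. Qed.

Lemma marginalD n k (X Y : 'M[C]_(pdim n k)) i :
  marginal (X + Y) i = marginal X i + marginal Y i.
Proof. by rewrite -[X in marginal (X + _)]scale1r marginalP scale1r. Qed.

Lemma marginal_tpow n (rho : 'M[C]_n) k i : density rho -> (i < k)%N ->
  marginal (tpow rho k) i = rho.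
Proof.
move=> drho; elim: k i => [|k IH] [|i] //= ik.
  by rewrite ptrace2_tens (proj2 (density_tpow k drho)) scale1r.
by rewrite ptrace1_tens (proj2 drho) scale1r IH.
Qed.

(** Folding keeps [hs], so the bound of [gram_entry_le] survives any number of partial traces,
    uniformly in [k] and the dimension. The column size [p] changes along the induction. *)
Lemma marginal_gram_le n k p (c : C) (K D : 'M[C]_(pdim n k, p)) i a b : 0 < c ->
  (i < k)%N -> hs K <= 1 -> hs D <= c ^+ 2 ->
  `|marginal (K *m adjmx D) i a b| <= c.
Proof.
move=> c0; elim: k p K D i => [|k IH] p K D [|i] //= ik hK hD.
  by rewrite ptrace2_gram; apply: gram_entry_le; rewrite ?hs_fold2.
by rewrite ptrace1_gram; apply: IH; rewrite ?hs_fold1.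
Qed.

End LocalMonotonicity.

(** * Typical projectors *)

Section Typicality.
Variable R : realType.
Local Notation C := (R[i]).

(** An index below [pdim n k] encodes a word of [k] letters. For a probability vector these are the
    weights of an i.i.d. source; for a spectrum they are the eigenvalues of the tensor power. *)
Fixpoint iid_prod n (d : 'I_n -> R) k : 'I_(pdim n k) -> R :=
  match k with
  | 0%N => fun=> 1
  | k'.+1 => fun x => d (mxtens_unindex x).1 * @iid_prod n d k' (mxtens_unindex x).2
  end.

Fixpoint iid_sum n (h : 'I_n -> R) k : 'I_(pdim n k) -> R :=
  match k with
  | 0%N => fun=> 0
  | k'.+1 => fun x => h (mxtens_unindex x).1 + @iid_sum n h k' (mxtens_unindex x).2
  end.

Lemma iid_prodS n (d : 'I_n -> R) k i j :
  iid_prod d (k := k.+1) (mxtens_index (i, j)) = d i * iid_prod d j.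
Proof.
rewrite [LHS]/(d (mxtens_unindex (mxtens_index (i, j))).1 *
  iid_prod d (mxtens_unindex (mxtens_index (i, j))).2).
by rewrite mxtens_indexK.
Qed.

Lemma iid_sumS n (h : 'I_n -> R) k i j :
  iid_sum h (k := k.+1) (mxtens_index (i, j)) = h i + iid_sum h j.
Proof.
rewrite [LHS]/(h (mxtens_unindex (mxtens_index (i, j))).1 +
  iid_sum h (mxtens_unindex (mxtens_index (i, j))).2).
by rewrite mxtens_indexK.
Qed.

Lemma pdimSP n k (x : 'I_(pdim n k.+1)) : exists i (j : 'I_(pdim n k)), x = mxtens_index (i, j).
Proof. by case: (@mxtens_indexP n (pdim n k) x) => i j; exists i, j. Qed.

Lemma sum_pdimS n k (F : 'I_(pdim n k.+1) -> R) :
  \sum_x F x = \sum_(i < n) \sum_(j < pdim n k) F (mxtens_index (i, j)).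
Proof. exact: sum_mxtens. Qed.

Lemma iid_prod_ge0 n (d : 'I_n -> R) k x : (forall i, 0 <= d i) -> 0 <= iid_prod d (k := k) x.
Proof.
move=> d0; elim: k x => [|k IH] x //.
by have [i [j ->]] := pdimSP x; rewrite iid_prodS mulr_ge0.
Qed.

Lemma iid_prod_exp n (d : 'I_n -> R) k x : (forall i, 0 <= d i) ->
  0 < iid_prod d (k := k) x -> iid_prod d x = expR (iid_sum (fun i => ln (d i)) x).
Proof.
move=> d0; elim: k x => [|k IH] x; first by rewrite /= expR0.
have [i [j ->]] := pdimSP x; rewrite iid_prodS iid_sumS => h; have d1 : 0 < d i.
  rewrite lt_neqAle d0 andbT eq_sym; apply: contraTneq h => ->.
  by rewrite mul0r ltxx.
rewrite pmulr_rgt0 // in h.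
by rewrite expRD lnK ?posrE // -IH.
Qed.

Lemma iid_prod_support n (d q : 'I_n -> R) k x : (forall i, d i = 0 -> q i = 0) ->
  iid_prod d (k := k) x = 0 -> iid_prod q x = 0.
Proof.
move=> dq; elim: k x => [|k IH] x; first by move/eqP; rewrite /= oner_eq0.
have [i [j ->]] := pdimSP x; rewrite !iid_prodS => /eqP; rewrite mulf_eq0 => /orP[] /eqP.
  by move=> /dq ->; rewrite mul0r.
by move=> /IH ->; rewrite mulr0.
Qed.

Lemma sum_iid_prod n (q : 'I_n -> R) k : \sum_i q i = 1 -> \sum_x iid_prod q (k := k) x = 1.
Proof.
move=> q1; elim: k => [|k IH]; first by rewrite big_ord1.
rewrite sum_pdimS -[RHS]q1; apply: eq_bigr => i _.
under eq_bigr do rewrite iid_prodS.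
by rewrite -mulr_sumr IH mulr1.
Qed.

Lemma iid_mean n (q h : 'I_n -> R) mu k : \sum_i q i = 1 -> \sum_i q i * h i = mu ->
  \sum_x iid_prod q (k := k) x * (iid_sum h x - k%:R * mu) = 0.
Proof.
move=> q1 qh; elim: k => [|k IH]; first by rewrite big_ord1 /= mul0r subr0 mulr0.
rewrite sum_pdimS.
transitivity (\sum_i (q i * (h i - mu))); last first.
  under eq_bigr do rewrite mulrBr.
  by rewrite sumrB qh -mulr_suml q1 mul1r subrr.
apply: eq_bigr => i _.
under eq_bigr => j _.
  rewrite iid_prodS iid_sumS.
  have -> : q i * iid_prod q j * (h i + iid_sum h j - k.+1%:R * mu) =
     q i * (h i - mu) * iid_prod q j + q i * (iid_prod q j * (iid_sum h j - k%:R * mu)).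
    by rewrite -natr1; ring.
  over.
by rewrite big_split /= -!mulr_sumr IH mulr0 addr0 sum_iid_prod // mulr1.
Qed.

(** Variances of independent letters add: the cross term vanishes by [iid_mean]. *)
Lemma iid_variance n (q h : 'I_n -> R) mu k : \sum_i q i = 1 -> \sum_i q i * h i = mu ->
  \sum_x iid_prod q (k := k) x * (iid_sum h x - k%:R * mu) ^+ 2 =
  k%:R * \sum_i q i * (h i - mu) ^+ 2.
Proof.
move=> q1 qh; elim: k => [|k IH]; first by rewrite big_ord1 /= !mul0r subr0 expr0n mulr0.
rewrite sum_pdimS; set v := \sum_i q i * _ in IH *.
transitivity (\sum_i (q i * (h i - mu) ^+ 2 + q i * (k%:R * v))); last first.
  by rewrite big_split /= -mulr_suml q1 mul1r -natr1 mulrDl mul1r addrC.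
apply: eq_bigr => i _.
under eq_bigr => j _.
  rewrite iid_prodS iid_sumS.
  have -> : q i * iid_prod q j * (h i + iid_sum h j - k.+1%:R * mu) ^+ 2 =
     q i * (h i - mu) ^+ 2 * iid_prod q j
     + q i * (h i - mu) * 2 * (iid_prod q j * (iid_sum h j - k%:R * mu))
     + q i * (iid_prod q j * (iid_sum h j - k%:R * mu) ^+ 2).
    by rewrite -natr1; ring.
  over.
by rewrite !big_split /= -!mulr_sumr IH iid_mean // mulr0 addr0 sum_iid_prod // mulr1.
Qed.

(** The variance of the sum grows like [k], the squared threshold like [k ^+ 2]. *)
Lemma iid_chebyshev n (q h : 'I_n -> R) mu eps del :
  (forall i, 0 <= q i) -> \sum_i q i = 1 -> \sum_i q i * h i = mu ->
  0 < eps -> 0 < del ->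
  exists k0, forall k, (k0 <= k)%N ->
    \sum_(x | k%:R * eps < `|iid_sum h x - k%:R * mu|) iid_prod q (k := k) x <= del.
Proof.
move=> q0 q1 qh e0 d0; set v := \sum_i q i * (h i - mu) ^+ 2.
have v0 : 0 <= v by apply: sumr_ge0 => i _; rewrite mulr_ge0 ?sqr_ge0.
exists (Num.truncn (v / (eps ^+ 2 * del))).+1 => k hk.
have kv : v < k%:R * (eps ^+ 2 * del).
  rewrite -ltr_pdivrMr ?mulr_gt0 ?exprn_gt0 //.
  by apply: lt_le_trans (truncnS_gt _) _; rewrite ler_nat.
have k1 : 0 < k%:R :> R by rewrite ltr0n (leq_trans _ hk).
have ke : 0 < (k%:R * eps) ^+ 2 by rewrite exprn_gt0 ?mulr_gt0.
rewrite -(ler_pM2l ke) mulr_sumr.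
apply: (@le_trans _ _ (k%:R * v)); last first.
  have -> : (k%:R * eps) ^+ 2 * del = k%:R * (k%:R * (eps ^+ 2 * del)) by ring.
  by rewrite ler_pM2l // ltW.
rewrite -(iid_variance k q1 qh) [X in _ <= X](bigID (fun x => k%:R * eps < `|iid_sum h x - k%:R * mu|)) /=.
rewrite -[X in X <= _]addr0; apply: lerD.
  apply: ler_sum => x hx; rewrite mulrC; apply: ler_wpM2l; first exact: iid_prod_ge0.
  rewrite -[X in _ <= X]real_normK ?num_real //; apply: lerXn2r; rewrite ?nnegrE //.
    by rewrite ltW ?mulr_gt0.
  exact: ltW.
by apply: sumr_ge0 => x _; rewrite mulr_ge0 ?sqr_ge0 ?iid_prod_ge0.
Qed.

(** * Tensor powers in a spectral basis, and typical projectors *)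

Lemma unitary_tpow n (U : 'M[C]_n) k : unitary U -> unitary (tpow U k).
Proof.
move=> uU; elim: k => [|k IH] /=; first by rewrite /unitary adjmx1 mulmx1.
rewrite /unitary adjmx_tens tensmx_mul uU IH; apply/matrixP=> u v.
case: (mxtens_indexP u) => i a; case: (mxtens_indexP v) => j b.
by rewrite tensmxE !id_mxE (can_eq (@mxtens_indexK _ _)) xpair_eqE -natrM mulnb.
Qed.

Lemma tens_sd m n (U : 'M[C]_m) (V : 'M[C]_n) d e :
  tensmx (sd U d) (sd V e) =
  sd (tensmx U V) (fun x => d (mxtens_unindex x).1 * e (mxtens_unindex x).2).
Proof.
rewrite /sd -!tensmx_mul adjmx_tens; congr (_ *m _ *m _).
apply/matrixP=> u v; case: (mxtens_indexP u) => i a; case: (mxtens_indexP v) => j b.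
rewrite tensmxE !mxE (can_eq (@mxtens_indexK _ _)) xpair_eqE !mxtens_indexK /= rmorphM.
by case: (i == j); case: (a == b); rewrite ?(mulr1n, mulr0n, mul0r, mulr0).
Qed.

Lemma tpow_sd n (U : 'M[C]_n) d k : tpow (sd U d) k = sd (tpow U k) (iid_prod d (k := k)).
Proof.
elim: k => [|k IH] /=; last by rewrite IH tens_sd.
by rewrite sd1 // /unitary adjmx1 mulmx1.
Qed.

(** [rho] need not be diagonal in the basis [U]: only its diagonal there enters, and on tensor
    powers this is an i.i.d. law. Noncommuting pairs thus reduce to classical sums. *)
Lemma tpow_diag n (U rho : 'M[C]_n) (q : 'I_n -> R) k x :
  (forall i, (U *m rho *m adjmx U) i i = ((q i)%:C)%C) ->
  (tpow U k *m tpow rho k *m adjmx (tpow U k)) x x = ((iid_prod q x)%:C)%C.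
Proof.
move=> qE; elim: k x => [|k IH] x.
  by rewrite /= adjmx1 !mulmx1 id_mxE eqxx.
rewrite adjmx_tens !tensmx_mul; have [i [a ->]] := pdimSP x.
by rewrite tensmxE qE IH iid_prodS rmorphM.
Qed.

Lemma density_le1 n (rho : 'M[C]_n) : density rho -> psd (1%:M - rho).
Proof.
move=> [pr tr]; have [uU d0 rE] := psd_spectral pr.
rewrite -(sd1 uU) {2}rE sdB; apply: psd_sd => i; rewrite subr_ge0.
move: tr; rewrite {1}rE tr_sd // -rmorph_sum => /complexI <-.
by rewrite (bigD1 i) //= lerDl; apply: sumr_ge0.
Qed.

Definition projector n (P : 'M[C]_n) := P *m P = P /\ adjmx P = P.

Lemma projectorC n (P : 'M[C]_n) : projector P -> projector (1%:M - P).
Proof.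
move=> [PP aP]; split; last by rewrite adjmxB adjmx1 aP.
by rewrite mulmxBl !mulmxBr !mulmx1 !mul1mx PP subrr subr0.
Qed.

Lemma psd_projector n (P : 'M[C]_n) : projector P -> psd P.
Proof. by move=> [PP aP]; rewrite -PP -{2}aP; apply: psd_gram. Qed.

Lemma mxlog_sd n (A : 'M[C]_n) : psd A ->
  mxlog A = sd (spectralmx A) (fun i => ln (complex.Re (spectral_diag A 0 i))).
Proof.
move=> pA; have [uU _ _] := psd_spectral pA.
rewrite /mxlog /mxfun /sd; congr (_ *m diag_mx _ *m _).
  by rewrite -[invmx _]mulmx1 -uU mulmxA mulVmx ?mul1mx ?spectral_unit.
by apply/rowP=> i; rewrite !mxE.
Qed.

(* The typical set also requires [0 < iid_prod d x] because [ln 0 = 0]: otherwise the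
   eigenvalue 0 of [tau] would count as 1. *)
Lemma typical_projector n (rho tau : 'M[C]_n) (c eps del : R) :
  density rho -> psd tau -> 0 < c -> psd (tau - (c%:C)%C *: rho) -> 0 < eps -> 0 < del ->
  forall mu, complex.Re (\tr (rho *m mxlog tau)) = mu ->
  exists k0, forall k, (k0 <= k)%N -> exists P : 'M[C]_(pdim n k),
  [/\ projector P,
      \tr (tpow rho k *m (1%:M - P)) <= (del%:C)%C,
      psd (((expR (k%:R * (mu + eps)))%:C)%C *: 1%:M - P *m tpow tau k *m P)
    & psd (tpow tau k - ((expR (k%:R * (mu - eps)))%:C)%C *: P)].
Proof.
move=> [prho trho] ptau c0 tau_ge e0 del0 mu muD.
have [uU d0 tauE] := psd_spectral ptau.
have muE := mxlog_sd ptau.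
pose d i := complex.Re (spectral_diag tau 0 i).
have {}d0 : forall i, 0 <= d i := d0.
have {}tauE : tau = sd (spectralmx tau) d := tauE.
have {}muE : mxlog tau = sd (spectralmx tau) (fun i => ln (d i)) := muE.
move: (spectralmx tau) d uU d0 tauE muE => U d uU d0 tauE muE {ptau}.
(* The outcome law of [rho] measured in the eigenbasis of [tau]; the mean of [ln (d i)] under it is
   [mu]. *)
pose q i := complex.Re ((U *m rho *m adjmx U) i i).
have qge i := psd_diag_ge0 i (psd_congr U prho).
have qE i : (U *m rho *m adjmx U) i i = ((q i)%:C)%C.
  by apply/esym/RRe_real/ger0_real.
have q0 i : 0 <= q i by have := qge i; rewrite qE ler0c.
have q1 : \sum_i q i = 1.
  apply: complexI; rewrite rmorph_sum /=.
  under eq_bigr do rewrite -qE.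
  by rewrite -/(mxtrace _) mxtrace_mulC mulmxA (unitary_adjK uU) mul1mx trho.
have qmu : \sum_i q i * ln (d i) = mu.
  rewrite -muD muE tr_mul_sd.
  under [X in complex.Re X]eq_bigr do rewrite qE -rmorphM.
  by rewrite -rmorph_sum.
(* Domination of a multiple of [rho] by [tau] puts the support of [q] inside that of [d]. *)
have dq i : d i = 0 -> q i = 0.
  move=> di; apply/eqP; rewrite eq_le q0 andbT.
  have := psd_diag_ge0 i (psd_congr U tau_ge).
  rewrite mulmxBr mulmxBl -scalemxAr -scalemxAl mxE [X in _ <= _ + X]mxE [X in _ <= _ - X]mxE qE.
  rewrite {1}tauE (sd_diag _ _ uU) di.
  by rewrite sub0r -rmorphM -rmorphN ler0c oppr_ge0 pmulr_rle0.
have [k0 Hk] := iid_chebyshev q0 q1 qmu e0 del0.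
exists k0 => k /Hk {}Hk.
pose t (x : 'I_(pdim n k)) := (`|iid_sum (fun i => ln (d i)) x - k%:R * mu| <= k%:R * eps)
  && (0 < iid_prod d x).
pose ind x : R := (t x)%:R.
have uUk := unitary_tpow k uU.
have indM x : ind x * ind x = ind x by rewrite /ind -natrM mulnb andbb.
have tb x : t x -> expR (k%:R * (mu - eps)) <= iid_prod d x <= expR (k%:R * (mu + eps)).
  move=> /andP[]; rewrite ler_norml => /andP[h1 h2] h3.
  rewrite (iid_prod_exp d0 h3) !ler_expR mulrBr mulrDr.
  by apply/andP; split; [rewrite addrC -lerBrDr | rewrite -lerBlDl].
exists (sd (tpow U k) ind); split.
- split; last by rewrite adjmx_sd.
  by rewrite (sdM _ _ uUk); apply: sd_ext.
- rewrite -(sd1 uUk) sdB tr_mul_sd.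
  under eq_bigr do rewrite (tpow_diag _ qE) -rmorphM.
  rewrite -rmorph_sum lecR; apply: le_trans Hk; rewrite [X in _ <= X]big_mkcond /=.
  apply: ler_sum => x _; rewrite /ind /t.
  case: (leP `|_| (k%:R * eps)) => _ /=; last by rewrite subr0 mulr1.
  case: ltP => /= h; first by rewrite subrr mulr0.
  (* Words excluded only because their [d]-product is 0 have weight 0 under [q], so they add nothing
     to the Chebyshev bound. *)
  rewrite (iid_prod_support dq) ?mul0r //; apply/eqP.
  by rewrite eq_le h iid_prod_ge0.
- rewrite {1}tauE tpow_sd !(sdM _ _ uUk) -(sd1 uUk) sdZ sdB; apply: psd_sd => x.
  rewrite subr_ge0 mulr1 mulrAC indM /ind.
  by case: (boolP (t x)) => [/tb /andP[]|_]; rewrite ?mul1r // mul0r expR_ge0.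
- rewrite {1}tauE tpow_sd sdZ sdB; apply: psd_sd => x; rewrite subr_ge0 /ind.
  case: (boolP (t x)) => [/tb /andP[]|_]; rewrite ?mulr1 // mulr0 iid_prod_ge0 //.
Qed.

Lemma hs_projector n p (P : 'M[C]_n) (r : 'M[C]_(n, p)) : projector P ->
  hs (P *m r) = \tr (r *m adjmx r *m P).
Proof.
move=> [PP aP]; rewrite /hs adjmxM aP -mulmxA mxtrace_mulC.
by rewrite -!mulmxA PP.
Qed.

Lemma hs_projector_le n p (P : 'M[C]_n) (r : 'M[C]_(n, p)) : projector P ->
  hs (P *m r) <= hs r.
Proof.
move=> pP; have [PP aP] := pP; apply: hs_mulr_le; rewrite aP PP.
exact/psd_projector/projectorC.
Qed.

(** Gentle measurement: the deviation is the part rejected by [Q] plus the part rejected by [P], the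
    latter contracted by [Q]. *)
Lemma hs_gentle n p (P Q : 'M[C]_n) (r : 'M[C]_(n, p)) : projector P -> projector Q ->
  hs (r - Q *m (P *m r)) <= 2 * (hs ((1%:M - Q) *m r) + hs ((1%:M - P) *m r)).
Proof.
move=> pP pQ.
have -> : r - Q *m (P *m r) = (1%:M - Q) *m r + Q *m ((1%:M - P) *m r).
  by rewrite !mulmxBl !mul1mx mulmxBr addrA subrK.
apply: (le_trans (hsD _ _)); rewrite ler_pM2l // lerD2l; exact: hs_projector_le.
Qed.

(** Rejection means rejection by [Q], or acceptance by [Q] and then rejection by [P]. In the second
    event [Q r] is replaced by [r - (1 - Q) r], which costs a factor 2 on both terms; hence 3 and
    2. *)
Lemma tr_sandwich n p (P Q : 'M[C]_n) (r : 'M[C]_(n, p)) : projector P -> projector Q ->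
  \tr (r *m adjmx r *m (1%:M - Q *m P *m Q)) <=
  3 * hs ((1%:M - Q) *m r) + 2 * hs ((1%:M - P) *m r).
Proof.
move=> pP pQ; have [QQ aQ] := pQ; have pP' := projectorC pP; have pQ' := projectorC pQ.
have -> : 1%:M - Q *m P *m Q = (1%:M - Q) + Q *m (1%:M - P) *m Q.
  by rewrite mulmxBr mulmxBl mulmx1 QQ addrA subrK.
rewrite mulmxDr raddfD /= -hs_projector //.
have -> : \tr (r *m adjmx r *m (Q *m (1%:M - P) *m Q)) = hs ((1%:M - P) *m (Q *m r)).
  by rewrite hs_projector // adjmxM aQ !mulmxA mxtrace_mulC !mulmxA.
have -> : (1%:M - P) *m (Q *m r) = (1%:M - P) *m r - (1%:M - P) *m ((1%:M - Q) *m r).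
  by rewrite -mulmxBr; congr (_ *m _); rewrite mulmxBl mul1mx opprB addrC subrK.
have h := hs_projector_le ((1%:M - Q) *m r) pP'.
apply: (@le_trans _ _ (hs ((1%:M - Q) *m r) + 2 * (hs ((1%:M - P) *m r) + hs ((1%:M - Q) *m r)))).
  rewrite lerD2l; apply: (le_trans (hsB _ _)); rewrite ler_pM2l // lerD2l //.
move: (hs _) (hs _) => b a; have -> : a + 2 * (b + a) = 3 * a + 2 * b by ring.
exact: lexx.
Qed.

End Typicality.

(** * Stein tests and smoothing *)

Section Asymptotics.
Variable R : realType.
Local Notation C := (R[i]).

Lemma rel_entropyE n (rho sigma : 'M[C]_n) :
  rel_entropy rho sigma =
  complex.Re (\tr (rho *m mxlog rho)) - complex.Re (\tr (rho *m mxlog sigma)).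
Proof.
have ReB (x y : C) : complex.Re (x - y) = complex.Re x - complex.Re y by case: x; case: y.
by rewrite /rel_entropy mulmxBr [\tr _]raddfB ReB.
Qed.

(** [P] is typical for [rho] in its own eigenbasis, with exponent [mu]; [Q] is typical for [rho] in
    the eigenbasis of [sigma], with exponent [nu]. *)
Lemma typical_pair n (rho sigma : 'M[C]_n) (eps del : R) :
  density rho -> full_rank_state sigma -> 0 < eps -> 0 < del ->
  exists mu nu k0, rel_entropy rho sigma = mu - nu /\ forall k, (k0 <= k)%N -> exists P Q r : 'M[C]_(pdim n k),
  [/\ [/\ projector P, projector Q & tpow rho k = r *m adjmx r],
      hs ((1%:M - P) *m r) <= (del%:C)%C /\ hs ((1%:M - Q) *m r) <= (del%:C)%C,
      psd (((expR (k%:R * (mu + eps)))%:C)%C *: 1%:M - P *m tpow rho k *m P),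
      \tr P <= ((expR (- (k%:R * (mu - eps))))%:C)%C
    & psd (((expR (k%:R * (nu + eps)))%:C)%C *: 1%:M - Q *m tpow sigma k *m Q) /\
      psd (tpow sigma k - ((expR (k%:R * (nu - eps)))%:C)%C *: Q)].
Proof.
move=> drho [[psigma tsigma] usigma] e0 d0.
have prho := proj1 drho.
have [mu muE] : exists mu, complex.Re (\tr (rho *m mxlog rho)) = mu by eexists.
have [nu nuE] : exists nu, complex.Re (\tr (rho *m mxlog sigma)) = nu by eexists.
have rho_rho : psd (rho - ((1 : R)%:C)%C *: rho) by rewrite scale1r subrr; apply: psd0.
have [c c0 sigma_c] := full_rank_ge_scalar psigma usigma.
(* [sigma] dominates [c] times the identity, which dominates [c] times [rho]. *)
have sigma_rho : psd (sigma - (c%:C)%C *: rho).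
  apply: psd_le_trans _ sigma_c; rewrite -scalerBr; apply: psdZ; last exact: density_le1.
  by rewrite ler0c ltW.
have [k1 H1] := typical_projector drho prho ltr01 rho_rho e0 d0 muE.
have [k2 H2] := typical_projector drho psigma c0 sigma_rho e0 d0 nuE.
exists mu, nu, (maxn k1 k2); split; first exact: etrans (rel_entropyE rho sigma) (congr2 (fun x y => x - y) muE nuE).
move=> k; rewrite geq_max => /andP[/H1 [P [pP trP P1 P2]] /H2 [Q [pQ trQ Q1 Q2]]].
have [r rE] := psd_root (proj1 (density_tpow k drho)).
exists P, Q, r; split; [exact: And3 pP pQ rE | | exact: P1 | | exact: conj Q1 Q2].
  by rewrite (hs_projector _ (projectorC pP)) (hs_projector _ (projectorC pQ)) -rE.
(* The trace of [rho^k >= exp(k(mu - eps)) P] bounds the rank of [P]. *)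
have := psd_tr_ge0 P2.
rewrite raddfB /= mxtraceZ (proj2 (density_tpow k drho)) subr_ge0.
rewrite expRN -[X in X^-1]/(expR _) fmorphV /= => h.
by rewrite -[X in _ <= X]mul1r ler_pdivlMr ?ltcR ?expR_gt0 // mulrC.
Qed.

(* The test is [Q P Q]. Since [tr P <= exp(-k(mu - eps))] and [Q sigma^k Q <=
   exp(k(nu + eps))], no pinching or operator convexity is needed. *)
Lemma stein_test n (rho sigma : 'M[C]_n) (eps del : R) :
  density rho -> full_rank_state sigma -> 0 < eps -> 0 < del ->
  exists k0, forall k, (k0 <= k)%N -> exists T : 'M[C]_(pdim n k),
  [/\ psd T, psd (1%:M - T),
      \tr (T *m tpow sigma k) <= ((expR (- (k%:R * (rel_entropy rho sigma - 2 * eps))))%:C)%C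
    & \tr ((1%:M - T) *m tpow rho k) <= ((5 * del)%:C)%C].
Proof.
move=> drho fsigma e0 d0; have [mu [nu [k0 [Smn H]]]] := typical_pair drho fsigma e0 d0.
exists k0 => k /H [P [Q [r [[pP pQ rE] [hP hQ] _ trP [Q1 _]]]]].
have sandwich X : psd X -> psd (Q *m X *m Q).
  by move=> /(psd_congr Q); rewrite (proj2 pQ).
have pT := sandwich P (psd_projector pP).
exists (Q *m P *m Q); split; first exact: pT.
- have -> : 1%:M - Q *m P *m Q = (1%:M - Q) + Q *m (1%:M - P) *m Q.
    by rewrite mulmxBr mulmxBl mulmx1 (proj1 pQ) addrA subrK.
  apply: psdD; first exact/psd_projector/projectorC.
  exact/sandwich/psd_projector/projectorC.
- have -> : \tr (Q *m P *m Q *m tpow sigma k) = \tr (P *m (Q *m tpow sigma k *m Q)).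
    by rewrite -!mulmxA mxtrace_mulC !mulmxA.
  apply: (le_trans (psd_trM_le (psd_projector pP) Q1)).
  rewrite -scalemxAr mulmx1 mxtraceZ Smn.
  have -> : - (k%:R * (mu - nu - 2 * eps)) = k%:R * (nu + eps) + - (k%:R * (mu - eps)) by ring.
  by rewrite expRD rmorphM; apply: ler_wpM2l trP; rewrite ler0c expR_ge0.
- rewrite mxtrace_mulC rE; apply: (le_trans (tr_sandwich _ pP pQ)).
  have -> : ((5 * del)%:C)%C = 3 * (del%:C)%C + 2 * (del%:C)%C :> C.
    by rewrite -mulrDl rmorphM rmorph_nat; congr (_ * _); ring.
  exact: lerD (ler_wpM2l (ler0n _ _) hQ) (ler_wpM2l (ler0n _ _) hP).
Qed.

(* [K = Q P r] with [rho^k = r r^*]: the state [K K^*] is a smoothing of [rho^k]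
   whose max-relative entropy to [sigma^k] is about [k S(rho||sigma)]. *)
Lemma smoothing n (rho sigma : 'M[C]_n) (eps del : R) :
  density rho -> full_rank_state sigma -> 0 < eps -> 0 < del ->
  exists k0, forall k, (k0 <= k)%N -> exists K r : 'M[C]_(pdim n k),
  [/\ tpow rho k = r *m adjmx r, hs (r - K) <= ((4 * del)%:C)%C,
      hs K <= 1, 1 - hs K <= ((5 * del)%:C)%C
    & psd (((expR (k%:R * (rel_entropy rho sigma + 2 * eps)))%:C)%C *: tpow sigma k -
       K *m adjmx K)].
Proof.
move=> drho fsigma e0 d0; have [mu [nu [k0 [Smn H]]]] := typical_pair drho fsigma e0 d0.
exists k0 => k /H [P [Q [r [[pP pQ rE] [hP hQ] P1 _ [_ Q2]]]]].
have hsr : hs r = 1 by rewrite /hs -rE (proj2 (density_tpow k drho)).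
have [[PP aP] [QQ aQ]] := (pP, pQ).
exists (Q *m (P *m r)), r; split; first exact: rE.
- apply: (le_trans (hs_gentle _ pP pQ)).
  have -> : ((4 * del)%:C)%C = 2 * ((del%:C)%C + (del%:C)%C) :> C.
    by rewrite rmorphM rmorph_nat; ring.
  exact: (ler_wpM2l (ler0n _ _) (lerD hQ hP)).
- by apply: (le_trans (hs_projector_le _ pQ)); rewrite -hsr; apply: hs_projector_le.
(* The lost weight is the rejection probability of [P Q P], so [tr_sandwich] applies with the
   projectors exchanged. *)
- have -> : 1 - hs (Q *m (P *m r)) = \tr (r *m adjmx r *m (1%:M - P *m Q *m P)).
    rewrite mulmxBr raddfB /= mulmx1 -/(hs r) hsr; congr (_ - _).
    rewrite (hs_projector _ pQ) adjmxM aP -!mulmxA [LHS]mxtrace_mulC.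
    by rewrite !mulmxA.
  apply: (le_trans (tr_sandwich _ pQ pP)).
  have -> : ((5 * del)%:C)%C = 3 * (del%:C)%C + 2 * (del%:C)%C :> C.
    by rewrite -mulrDl rmorphM rmorph_nat; congr (_ * _); ring.
  exact: lerD (ler_wpM2l (ler0n _ _) hP) (ler_wpM2l (ler0n _ _) hQ).
have -> : Q *m (P *m r) *m adjmx (Q *m (P *m r)) = Q *m (P *m tpow rho k *m P) *m Q.
  by rewrite rE !adjmxM aP aQ !mulmxA.
rewrite Smn.
have -> : k%:R * (mu - nu + 2 * eps) = k%:R * (mu + eps) + - (k%:R * (nu - eps)) by ring.
rewrite expRD expRN.
have c1 := expR_gt0 (k%:R * (mu + eps)); have c2 := expR_gt0 (k%:R * (nu - eps)).
move: (expR _) (expR _) c1 c2 P1 Q2 => a b b0 a0 P1 Q2.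
(* Conjugating [P rho^k P <= b] by [Q] bounds the smoothed state by [b Q], and [a Q <= sigma^k]
   bounds this by [(b / a) sigma^k]. *)
apply: (@psd_le_trans _ _ _ ((b%:C)%C *: Q)).
  have := psd_congr Q P1; rewrite aQ mulmxBr mulmxBl -scalemxAr -scalemxAl mulmx1 QQ.
  by [].
have -> : (b%:C)%C *: Q = ((b * a^-1)%:C)%C *: ((a%:C)%C *: Q).
  by rewrite scalerA -rmorphM divfK ?gt_eqF.
rewrite -scalerBr; apply: psdZ Q2.
by rewrite ler0c ltW // mulr_gt0 // invr_gt0.
Qed.

Lemma exp_decay (a c : R) : 0 < a -> exists k0, forall k, (k0 <= k)%N -> c * expR (- (k%:R * a)) < 1.
Proof.
move=> a0; exists (Num.truncn (`|c| / a)).+1 => k hk.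
rewrite expRN ltr_pdivrMr ?expR_gt0 // mul1r.
apply: (le_lt_trans (ler_norm c)); apply: lt_le_trans (expR_ge1Dx _).
apply: (@lt_trans _ _ (k%:R * a)); last by rewrite ltrDr.
by rewrite -ltr_pdivrMr //; apply: lt_le_trans (truncnS_gt _) _; rewrite ler_nat.
Qed.

(* If [S < 0], smoothing would dominate a matrix of trace close to 1 by one of trace
   tending to 0. *)
Lemma rel_entropy_ge0 n (rho sigma : 'M[C]_n) :
  density rho -> full_rank_state sigma -> 0 <= rel_entropy rho sigma.
Proof.
move=> drho fsigma.
(* With [del = 1/10] at most half the weight is lost; [eps = - S / 4] will make the domination
   factor [exp(k S / 2)], eventually below 1/2. *)
have H eps : 0 < eps -> _ := fun e0 => smoothing drho fsigma e0 (divr_gt0 ltr01 (ltr0n _ 10)).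
move: (rel_entropy rho sigma) H => S H; rewrite leNgt; apply/negP => S0.
have e0 : 0 < - S / 4 by rewrite divr_gt0 ?oppr_gt0.
have [k1 H1] := H _ e0.
have e2 : 0 < - S / 2 by rewrite divr_gt0 ?oppr_gt0.
have [k2 H2] := exp_decay 2 e2.
have [K [r [_ _ _ h1 h2]]] := H1 _ (leq_maxl k1 k2).
have := H2 _ (leq_maxr k1 k2).
move: (maxn k1 k2) K r h1 h2 => k K r h1 h2.
have := psd_tr_ge0 h2; rewrite raddfB /= mxtraceZ (proj2 (proj1 (full_rank_tpow k fsigma))).
rewrite mulr1 -/(hs K) subr_ge0 => h3.
have -> : - (k%:R * (- S / 2)) = k%:R * (S + 2 * (- S / 4)) by field.
move: (expR _) h3 => x h3 h4.
have : ((1 : R)%:C)%C <= ((x + 5 * (1 / 10%:R))%:C)%C :> C.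
  rewrite [X in _ <= X]rmorphD; apply: (le_trans _ (lerD h3 h1)).
  by rewrite addrC subrK.
rewrite lecR; lra.
Qed.

(** A positive definite [A] dominates a multiple of the identity, hence of [sigma], so [Phi A]
    dominates a multiple of the invertible [Phi sigma]. *)
Lemma faithful_of_state m n (Phi : 'M[C]_n -> 'M[C]_m) (sigma : 'M[C]_n) :
  kraus Phi -> (forall A, \tr (Phi A) = \tr A) -> density sigma ->
  full_rank_state (Phi sigma) -> faithful_channel Phi.
Proof.
move=> kPhi tPhi dsigma [[pPs _] uPs]; split; [exact: kPhi | exact: tPhi |] => A pA uA.
have [c c0 Ac] := full_rank_ge_scalar pA uA.
apply: (dominating_unit (c := (c%:C)%C) pPs uPs); first by rewrite ltcR.
have -> : Phi A - (c%:C)%C *: Phi sigma = Phi (A - (c%:C)%C *: sigma).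
  by rewrite [A - _]addrC -[in RHS]scaleNr (kraus_linear _ _ _ kPhi) scaleNr addrC.
apply: kraus_psd kPhi _; apply: psd_le_trans _ Ac; rewrite -scalerBr; apply: psdZ.
  by rewrite ler0c ltW.
exact: density_le1.
Qed.

(** [B] is the normalized remainder that sends [sigma] exactly to [tau]. The factor 2 keeps the
    acceptance probability of [sigma] at most 1/2, so the remainder has positive trace. *)
Lemma measure_prepare_channel m n (T sigma : 'M[C]_n) (A tau : 'M[C]_m) :
  psd T -> psd (1%:M - T) -> density sigma -> density A -> full_rank_state tau ->
  psd (tau - (2 * \tr (T *m sigma)) *: A) ->
  exists2 B, density B &
    let Phi X := \tr (T *m X) *: A + \tr ((1%:M - T) *m X) *: B in
    faithful_channel Phi /\ Phi sigma = tau.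
Proof.
move=> pT pT' dsigma dA ftau; set beta := \tr (T *m sigma) => h.
have beta0 : 0 <= beta by exact: psd_trM_ge0 pT (proj1 dsigma).
have beta1 : 2 * beta <= 1.
  have := psd_tr_ge0 h; rewrite raddfB /= mxtraceZ (proj2 dA) (proj2 (proj1 ftau)) mulr1.
  by rewrite subr_ge0.
have beta2 : 0 < 1 - beta.
  rewrite subr_gt0; apply: (@le_lt_trans _ _ (2^-1)).
    by rewrite -[X in _ <= X]mul1r ler_pdivlMr // mulrC.
  by rewrite invf_lt1 // ltr1n.
pose B := (1 - beta)^-1 *: (tau - beta *: A).
have dB : density B.
  split; last first.
    rewrite mxtraceZ raddfB /= mxtraceZ (proj2 dA) (proj2 (proj1 ftau)) mulr1.
    by rewrite mulVf ?gt_eqF.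
  apply: psdZ; first by rewrite invr_ge0 ltW.
  have -> : tau - beta *: A = (tau - (2 * beta) *: A) + beta *: A.
    by rewrite mulr_natl mulr2n scalerDl opprD addrA subrK.
  by apply: psdD h _; apply: psdZ (proj1 dA).
exists B => // Phi.
have Ps : Phi sigma = tau.
  rewrite /Phi /B -/beta mulmxBl mul1mx raddfB /= (proj2 dsigma) -/beta scalerA.
  by rewrite divff ?gt_eqF // scale1r addrC subrK.
split; last exact: Ps.
apply: (@faithful_of_state _ _ _ sigma _ _ dsigma).
- apply: krausD; first exact: kraus_measure_prepare pT (proj1 dA).
  exact: kraus_measure_prepare pT' (proj1 dB).
- move=> X; rewrite /Phi mxtraceD [\tr (_ *: A)]mxtraceZ [\tr (_ *: B)]mxtraceZ (proj2 dA) (proj2 dB) !mulr1.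
  by rewrite -mxtraceD -mulmxDl addrC subrK mul1mx.
by rewrite Ps.
Qed.

End Asymptotics.

(** * Asymptotic conversion *)

Section Conversion.
Variable R : realType.
Local Notation C := (R[i]).

Lemma marginal_adj n k (X : 'M[C]_(pdim n k)) i :
  marginal (adjmx X) i = adjmx (marginal X i).
Proof.
elim: k X i => [|k IH] X i.
  by apply/matrixP=> a b; rewrite !mxE conjC0.
case: i => [|i] /=.
  apply/matrixP=> a b; rewrite !mxE rmorph_sum.
  by apply: eq_bigr => x _; rewrite !mxE.
rewrite -IH; congr (marginal _ i).
apply/matrixP=> a b; rewrite !mxE rmorph_sum.
by apply: eq_bigr => x _; rewrite !mxE.
Qed.

Lemma marginal_close n k (rho : 'M[C]_n) (K r : 'M[C]_(pdim n k)) (c : C) i a b :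
  density rho -> tpow rho k = r *m adjmx r -> hs K <= 1 -> 0 < c -> hs (r - K) <= c ^+ 2 ->
  (i < k)%N -> `|rho a b - marginal (K *m adjmx K) i a b| <= 2 * c.
Proof.
move=> drho rE hK c0 hD ik.
have hr : hs r <= 1 by rewrite /hs -rE (proj2 (density_tpow k drho)).
(* Telescoping from [r] to [K]. The outer adjoint keeps [r - K] as the right Gram factor, as
   [marginal_gram_le] requires. *)
have E : r *m adjmx r = adjmx (r *m adjmx (r - K)) + K *m adjmx (r - K) + K *m adjmx K.
  rewrite adjmxM adjmxK adjmxB mulmxBl mulmxBr.
  by rewrite addrA subrK subrK.
rewrite -{1}(marginal_tpow drho ik) rE E !marginalD mxE addrK mxE marginal_adj adjmxE.
apply: (le_trans (ler_normD _ _)).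
rewrite mulr_natl mulr2n norm_conjC.
exact: lerD (marginal_gram_le _ _ c0 ik hr hD) (marginal_gram_le _ _ c0 ik hK hD).
Qed.

Lemma mixture_close n (A B rho : 'M[C]_n) (x y : C) a b :
  density A -> density B -> 0 <= y -> x + y = 1 ->
  `|rho a b - (x *: A + y *: B) a b| <= `|rho a b - A a b| + 2 * y.
Proof.
move=> dA dB y0 xy.
have -> : rho a b - (x *: A + y *: B) a b = (rho a b - A a b) + y * (A a b - B a b).
  by rewrite !mxE -[x](addrK y) xy; ring.
apply: (le_trans (ler_normD _ _)); rewrite lerD2l normrM (ger0_norm y0) mulrC.
apply: ler_wpM2r => //; apply: (le_trans (ler_normB _ _)).
by rewrite -[2]/(1 + 1); apply: lerD; apply: density_entry_le.
Qed.

(** [e1] bounds false acceptance of [sigma1], and [e2] is the domination factor of the smoothed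
    state. Of the error [5 * c], smoothing contributes [2 * c], normalization [c], and rejection of
    [rho1] the other [2 * c]. *)
Lemma one_shot_conversion N n l (T rho1 sigma1 : 'M[C]_N) (rho2 sigma2 : 'M[C]_n)
    (K r : 'M[C]_(pdim n l)) (e1 e2 c : C) :
  psd T -> psd (1%:M - T) -> density rho1 -> density sigma1 ->
  density rho2 -> full_rank_state sigma2 ->
  \tr (T *m sigma1) <= e1 -> \tr ((1%:M - T) *m rho1) <= c ->
  tpow rho2 l = r *m adjmx r -> hs (r - K) <= c ^+ 2 -> hs K <= 1 -> 1 - hs K <= c ->
  psd (e2 *: tpow sigma2 l - K *m adjmx K) -> 0 <= e1 -> 0 <= e2 -> 4 * (e1 * e2) <= 1 ->
  0 < c -> c <= 2^-1 ->
  exists2 Phi : 'M[C]_N -> 'M[C]_(pdim n l), faithful_channel Phi &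
    Phi sigma1 = tpow sigma2 l /\
    forall i a b, (i < l)%N -> `|rho2 a b - marginal (Phi rho1) i a b| <= 5 * c.
Proof.
move=> pT pT' dr1 ds1 dr2 fs2 Ts Tr rE hD hK1 hK2 domK e10 e20 e12 c0 c1.
have a2 : 2^-1 <= hs K.
  have : 1 - 2^-1 <= hs K by rewrite lerBlDl -lerBlDr; apply: (le_trans hK2).
  by congr (_ <= _); field.
have a0 : 0 < hs K by apply: lt_le_trans a2; rewrite invr_gt0.
pose A := (hs K)^-1 *: (K *m adjmx K).
have dA : density A.
  split; first by apply: psdZ (psd_gram K); rewrite invr_ge0 ltW.
  by rewrite mxtraceZ -/(hs K) mulVf ?gt_eqF.
have ftau := full_rank_tpow l fs2.
(* The coefficient of [K *m adjmx K] in the required domination. The 4 in the hypothesis is the 2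
   here times the bound 2 on [(hs K)^-1]. *)
pose w := 2 * \tr (T *m sigma1) * (hs K)^-1.
have b0 : 0 <= \tr (T *m sigma1) := psd_trM_ge0 pT (proj1 ds1).
have w0 : 0 <= w by apply: mulr_ge0; [apply: mulr_ge0 | rewrite invr_ge0 ltW].
have w1 : w * e2 <= 1.
  apply: (le_trans _ e12).
  have -> : 4 * (e1 * e2) = 2 * e1 * 2 * e2 by ring.
  apply: ler_wpM2r => //; apply: ler_pM.
  - exact: mulr_ge0.
  - by rewrite invr_ge0 ltW.
  - by apply: ler_wpM2l.
  - by rewrite -[X in _ <= X]invrK lef_pV2 ?posrE ?invr_gt0.
have domA : psd (tpow sigma2 l - (2 * \tr (T *m sigma1)) *: A).
  have -> : tpow sigma2 l - (2 * \tr (T *m sigma1)) *: A =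
      (1 - w * e2) *: tpow sigma2 l + w *: (e2 *: tpow sigma2 l - K *m adjmx K).
    by rewrite scalerBr !scalerA scalerBl scale1r addrA subrK.
  apply: psdD; last exact: psdZ.
  by apply: psdZ (proj1 (proj1 ftau)); rewrite subr_ge0.
have AE : K *m adjmx K = hs K *: A by rewrite scalerA divff ?gt_eqF // scale1r.
clearbody A.
have [B dB [FPhi PhiE]] := measure_prepare_channel pT pT' ds1 dA ftau domA.
exists (fun X => \tr (T *m X) *: A + \tr ((1%:M - T) *m X) *: B) => //.
split=> // i a b il.
have y0 : 0 <= \tr ((1%:M - T) *m rho1) := psd_trM_ge0 pT' (proj1 dr1).
have xy : \tr (T *m rho1) + \tr ((1%:M - T) *m rho1) = 1.
  by rewrite -mxtraceD -mulmxDl addrC subrK mul1mx (proj2 dr1).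
rewrite marginalP marginalZ.
have dmA := density_marginal dA il; have dmB := density_marginal dB il.
apply: (le_trans (mixture_close rho2 a b dmA dmB y0 xy)).
have -> : 5 * c = (2 * c + c) + 2 * c by ring.
apply: lerD; last by apply: ler_wpM2l.
have -> : rho2 a b - marginal A i a b =
    (rho2 a b - marginal (K *m adjmx K) i a b) - (1 - hs K) * marginal A i a b.
  by rewrite AE marginalZ mxE; ring.
apply: (le_trans (ler_normB _ _)); apply: lerD.
  exact: (marginal_close a b dr2 rE hK1 c0 hD il).
rewrite normrM ger0_norm ?subr_ge0 // -[X in _ <= X]mulr1.
by apply: ler_pM => //; [rewrite subr_ge0 | apply: density_entry_le].
Qed.

Variable f : Ffun R.
Hypothesis fM : locally_monotonic f.
Hypothesis fC : forall n (sigma : 'M[C]_n), full_rank_state sigma ->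
  continuous_on_states (fun rho => f rho sigma).

(* [n N] copies of the first pair are converted to [m N] approximate copies of the second;
   superadditivity only sees the marginals, so single-copy continuity of [f] suffices. *)
Lemma excess_conversion n1 n2 (r1 s1 : 'M[C]_n1) (r2 s2 : 'M[C]_n2) (n m : nat) :
  density r1 -> full_rank_state s1 -> density r2 -> full_rank_state s2 ->
  (0 < m)%N -> m%:R * rel_entropy r2 s2 < n%:R * rel_entropy r1 s1 ->
  m%:R * excess f r2 s2 <= n%:R * excess f r1 s1.
Proof.
move=> dr1 fs1 dr2 fs2 m0 Slt.
have S2_0 := rel_entropy_ge0 dr2 fs2.
have n0 : (0 < n)%N.
  case: n Slt => // Slt; move: (le_lt_trans (mulr_ge0 (ler0n _ m) S2_0) Slt).
  by rewrite mul0r ltxx.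
rewrite leNgt; apply/negP => Hlt.
(* Half of the assumed deficit, shared among the [m] copies: the loss allowed to continuity. *)
pose gap : R := (m%:R * excess f r2 s2 - n%:R * excess f r1 s1) / (2 * m%:R).
have mpos : 0 < m%:R :> R by rewrite ltr0n.
have gap0 : 0 < gap by rewrite divr_gt0 ?subr_gt0 // mulr_gt0.
have gapE : m%:R * gap = (m%:R * excess f r2 s2 - n%:R * excess f r1 s1) / 2.
  by rewrite /gap; field; rewrite gt_eqF.
clearbody gap.
have [del0 del0_gt0 Hcont] := fC fs2 dr2 gap0.
(* [2^-1] serves the one-shot conversion; [7] keeps its entry error [5 * c] strictly below
   [del0]. *)
pose c : R := Num.min 2^-1 (del0 / 7).
have c0 : 0 < c by rewrite lt_min invr_gt0 ltr0n divr_gt0.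
have c1 : c <= 2^-1 by rewrite ge_min lexx.
have c2 : 7 * c <= del0 by rewrite mulrC -ler_pdivlMr // ge_min lexx orbT.
clearbody c.
(* [smoothing] yields the bound [4 * del], which is [c ^+ 2]; the errors [5 * del] stay below [c]
   because [c <= 2^-1]. *)
pose del := c ^+ 2 / 4.
have del_gt0 : 0 < del by rewrite divr_gt0 ?exprn_gt0.
have delc : 5 * del <= c.
  by have h := ler_wpM2l (ltW c0) c1; rewrite /del expr2; clear - c0 h; lra.
have H1 e (e0 : 0 < e) := stein_test dr1 fs1 e0 del_gt0.
have H2 e (e0 : 0 < e) := smoothing dr2 fs2 e0 del_gt0.
move: (rel_entropy r1 s1) (rel_entropy r2 s2) Slt H1 H2 {S2_0} => S1 S2 Slt H1 H2.
(* Half of the entropy gap pays for the losses [2 * eps] on both sides; the other half, [G], is the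
   decay rate. *)
pose eps : R := (n%:R * S1 - m%:R * S2) / (4 * (n%:R + m%:R)).
have npos : 0 < n%:R :> R by rewrite ltr0n.
have nm0 : 0 < n%:R + m%:R :> R by rewrite addr_gt0.
have eps0 : 0 < eps by rewrite divr_gt0 ?subr_gt0 // mulr_gt0.
pose G := (n%:R * S1 - m%:R * S2) / 2.
have G0 : 0 < G by rewrite divr_gt0 ?subr_gt0.
have GE : m%:R * (S2 + 2 * eps) - n%:R * (S1 - 2 * eps) = - G.
  by rewrite /G /eps; field; rewrite gt_eqF.
have [k1 {}H1] := H1 _ eps0; have [k2 {}H2] := H2 _ eps0.
have [k3 H3] := exp_decay 4 G0.
(* At least 1, because [N] is cancelled at the end. *)
pose N := maxn 1 (maxn k1 (maxn k2 k3)).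
have N1 : (0 < N)%N by rewrite leq_max.
have Nk1 : (k1 <= n * N)%N.
  by rewrite (leq_trans _ (leq_pmull N n0)) // !leq_max leqnn ?orbT.
have Nk2 : (k2 <= m * N)%N.
  by rewrite (leq_trans _ (leq_pmull N m0)) // !leq_max leqnn ?orbT.
have Nk3 : (k3 <= N)%N by rewrite !leq_max leqnn ?orbT.
have [T [pT pT' Ts Tr]] := H1 _ Nk1.
have [K [r [rE hD hK1 hK2 domK]]] := H2 _ Nk2.
have {}H3 := H3 _ Nk3.
set k := (n * N)%N in T pT pT' Ts Tr; set l := (m * N)%N in K r rE hD hK1 hK2 domK.
have decay : 4 * (expR (- (k%:R * (S1 - 2 * eps))) * expR (l%:R * (S2 + 2 * eps))) <= 1.
  rewrite -expRD; apply: (le_trans _ (ltW H3)); rewrite ler_pM2l // ler_expR.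
  by rewrite /k /l !natrM -[G]opprK -GE le_eqVlt; apply/orP; left; apply/eqP; ring.
have hD' : hs (r - K) <= (c%:C)%C ^+ 2.
  by rewrite -rmorphXn; apply: (le_trans hD); rewrite lecR /del; lra.
have toC x : x <= ((5 * del)%:C)%C -> x <= (c%:C)%C :> C.
  by move=> h; apply: (le_trans h); rewrite lecR.
have cpos : 0 < (c%:C)%C :> C by rewrite ltcR.
have c12 : (c%:C)%C <= 2^-1 :> C by rewrite -(rmorph_nat (real_complex R) 2) -fmorphV lecR.
have e10 : 0 <= ((expR (- (k%:R * (S1 - 2 * eps))))%:C)%C :> C by rewrite ler0c expR_ge0.
have e20 : 0 <= ((expR (l%:R * (S2 + 2 * eps)))%:C)%C :> C by rewrite ler0c expR_ge0.
have dec : 4 * (((expR (- (k%:R * (S1 - 2 * eps))))%:C)%C *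
    ((expR (l%:R * (S2 + 2 * eps)))%:C)%C) <= 1 :> C.
  by rewrite -(rmorph_nat (real_complex R) 4) -!rmorphM -(rmorph1 (real_complex R)) lecR.
have [Phi FPhi [PhiE close]] := one_shot_conversion pT pT' (density_tpow k dr1)
  (density_tpow k (proj1 fs1)) dr2 fs2 Ts (toC _ Tr) rE hD' hK1 (toC _ hK2) domK e10 e20 dec
  cpos c12.
have [[_ PhiP PhiT] _] := faithful_channelP FPhi.
have dX : density (Phi (tpow r1 k)).
  have [pr tr] := density_tpow k dr1.
  by split; [apply: kraus_psd pr; case: FPhi | rewrite PhiT].
have lower i : (i < l)%N -> excess f r2 s2 - gap <= excess f (marginal (Phi (tpow r1 k)) i) s2.
  move=> il.
  have : `|f (marginal (Phi (tpow r1 k)) i) s2 - f r2 s2| < gap.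
    apply: Hcont => [|a b]; first exact: density_marginal.
    rewrite distrC; apply: (le_lt_trans (close i a b il)).
    rewrite -(rmorph_nat (real_complex R) 5) -rmorphM ltcR; lra.
  rewrite /excess ltr_norml => /andP[]; lra.
have := excess_ge_marginals fM dX fs2 lower.
rewrite -PhiE => h1.
have h2 := excess_monotone fM FPhi (density_tpow k dr1) (full_rank_tpow k fs1).
have h3 := excess_tpow_le fM k dr1 fs1.
have := le_trans h1 (le_trans h2 h3).
have Npos : 0 < N%:R :> R by rewrite ltr0n.
rewrite /l /k !natrM [m%:R * _]mulrC [n%:R * _]mulrC -!mulrA ler_pM2l // mulrBr gapE.
by move: Hlt; move: (m%:R * _) (n%:R * _) => a b; lra.
Qed.

End Conversion.

(** * A reference pair and the comparison of ratios *)

Section Reference.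
Variable R : realType.
Local Notation C := (R[i]).

(** The eigenvalues are 0 or 1, and [ln] vanishes at both, at 0 by convention. *)
Lemma mxlog_projector n (P : 'M[C]_n) : projector P -> mxlog P = 0.
Proof.
move=> pP; have psdP := psd_projector pP.
have [uU _ PE] := psd_spectral psdP; rewrite (mxlog_sd psdP).
pose d i := complex.Re (spectral_diag P 0 i).
rewrite -[LHS]/(sd (spectralmx P) (fun i => ln (d i))).
have {}PE : P = sd (spectralmx P) d := PE.
move: (spectralmx P) d uU PE => U d uU PE.
have d_idem i : d i * d i = d i.
  apply: complexI; rewrite -(sd_diag (fun i => d i * d i) i uU) -(sd_diag d i uU).
  by rewrite -(sdM _ _ uU) -PE (proj1 pP).
rewrite (@sd_ext _ _ _ _ (fun i => 0 * 1)).
  by rewrite -sdZ -[(0%:C)%C]/(0 : C) scale0r.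
move=> i; rewrite mul0r; have /eqP := d_idem i.
rewrite -subr_eq0 -[X in _ - X]mulr1 -mulrBr mulf_eq0 subr_eq0 => /orP[] /eqP ->.
  by rewrite ln0.
exact: ln1.
Qed.

Lemma mxlog_scalar n (c : R) : 0 < c ->
  mxlog ((c%:C)%C *: 1%:M : 'M[C]_n) = ((ln c)%:C)%C *: 1%:M.
Proof.
move=> c0; set A := _ *: 1%:M.
have pA : psd A by apply: psdZ (psd1 _ _); rewrite ler0c ltW.
rewrite (mxlog_sd pA); have [uU _ AE] := psd_spectral pA.
rewrite -(sd1 uU) sdZ; apply: sd_ext => i; rewrite mulr1; congr ln.
apply: complexI; have := sd_diag (fun i => complex.Re (spectral_diag A 0 i)) i uU.
rewrite -AE => <-.
by rewrite {2}/A -scalemxAr -scalemxAl mulmx1 uU !mxE eqxx mulr1.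
Qed.

(** A pure qubit state against the maximally mixed one has relative entropy [ln 2]. *)
Lemma exists_rel_entropy_gt0 : exists rho sigma : 'M[C]_2,
  [/\ density rho, full_rank_state sigma & 0 < rel_entropy rho sigma].
Proof.
pose rho : 'M[C]_2 := delta_mx 0 0.
have prho : projector rho by split; [apply: mul_delta_mx | apply: adjmx_delta].
have trho : \tr rho = 1 by rewrite /mxtrace big_ord_recl big_ord1 !mxE addr0.
have half0 : 0 < 2^-1 :> R by rewrite invr_gt0.
exists rho, (((2^-1 : R)%:C)%C *: 1%:M); split.
- by split; first exact: psd_projector.
- have h : ((2^-1 : R)%:C)%C != 0 :> C by rewrite gt_eqF // ltcR.
  split; last by rewrite unitmxZ ?unitmx1 // unitfE.
  split; first by apply: psdZ (psd1 _ _); rewrite ler0c ltW.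
  by rewrite mxtraceZ mxtrace1 -(rmorph_nat (real_complex R)) -rmorphM mulVf ?pnatr_eq0.
rewrite /rel_entropy (mxlog_projector prho) (mxlog_scalar _ half0) sub0r mulmxN -scalemxAr.
rewrite mulmx1 linearN /= mxtraceZ trho mulr1 /= oppr_gt0.
by apply: ln_lt0; rewrite half0 invf_lt1 ?ltr1n.
Qed.

Lemma archimedean_le0 (x y : R) : (forall m, (0 < m)%N -> m%:R * x <= y) -> x <= 0.
Proof.
move=> h; rewrite leNgt; apply/negP => x0.
have := h (Num.truncn (y / x)).+1 isT; apply/negP; rewrite -ltNge.
by rewrite -ltr_pdivrMr // truncnS_gt.
Qed.

(** Conversion is used at rates [n / m] just above the ratio of the entropies, in the limit of large
    [m]. *)
Lemma excess_cross_le (f : Ffun R) n1 n2 (r1 s1 : 'M[C]_n1) (r2 s2 : 'M[C]_n2) :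
  locally_monotonic f ->
  (forall n (sigma : 'M[C]_n), full_rank_state sigma ->
     continuous_on_states (fun rho => f n rho sigma)) ->
  density r1 -> full_rank_state s1 -> density r2 -> full_rank_state s2 ->
  0 < rel_entropy r1 s1 ->
  rel_entropy r1 s1 * excess f r2 s2 <= rel_entropy r2 s2 * excess f r1 s1.
Proof.
move=> fM fC dr1 fs1 dr2 fs2.
have S2 := rel_entropy_ge0 dr2 fs2; have g1 := excess_ge0 fM dr1 fs1.
have conv n m := @excess_conversion _ _ fM fC _ _ _ _ _ _ n m dr1 fs1 dr2 fs2.
move: (rel_entropy r1 s1) (rel_entropy r2 s2) (excess f r1 s1) (excess f r2 s2) S2 g1 conv.
move=> a b g h b0 g0 conv a0; rewrite -subr_le0.
apply: (@archimedean_le0 _ (a * g)) => m m0.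
(* The least integer with [n * a > m * b]. It overshoots by at most [a], which leaves an error
   [a * g] independent of [m]. *)
pose n := (Num.truncn (m%:R * b / a)).+1.
have nlt : m%:R * b < n%:R * a by rewrite -ltr_pdivrMr // truncnS_gt.
have nle : n%:R * a <= m%:R * b + a.
  rewrite -natr1 mulrDl mul1r lerD2r -ler_pdivlMr //.
  by rewrite truncn_le // divr_ge0 ?(ltW a0) // mulr_ge0.
have h1 := ler_wpM2l (ltW a0) (conv n m m0 nlt).
have h2 := ler_wpM2r g0 nle.
rewrite mulrBr lerBlDr mulrCA; apply: (le_trans h1).
by rewrite mulrCA mulrA (le_trans h2) // mulrDl addrC mulrA.
Qed.

End Reference.

Theorem theorem15 (R : realType) (f : forall n, 'M[R[i]]_n -> 'M[R[i]]_n -> R) :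
  locally_monotonic f ->
  (forall n (sigma : 'M[R[i]]_n), full_rank_state sigma ->
     continuous_on_states (fun rho => f n rho sigma)) ->
  exists a b : R, forall n (rho sigma : 'M[R[i]]_n),
    density rho -> full_rank_state sigma ->
    f n rho sigma = a * rel_entropy rho sigma + b.
Proof.
move=> fM fC; have [r0 [s0 [dr0 fs0 S0]]] := exists_rel_entropy_gt0 R.
exists (excess f r0 s0 / rel_entropy r0 s0), (f 1%N 1%:M 1%:M) => n rho sigma drho fsigma.
suff E : rel_entropy r0 s0 * excess f rho sigma = rel_entropy rho sigma * excess f r0 s0.
  have -> : f n rho sigma = excess f rho sigma + f 1%N 1%:M 1%:M by rewrite /excess subrK.
  by congr (_ + _); rewrite mulrAC [excess f r0 s0 * _]mulrC -E mulrAC divff ?mul1r ?gt_eqF.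
have le1 := excess_cross_le fM fC dr0 fs0 drho fsigma S0.
apply/eqP; rewrite eq_le le1 /=.
have := rel_entropy_ge0 drho fsigma; rewrite [0 <= _]le_eqVlt; case/orP => [/eqP <-|S1].
  by rewrite mul0r mulr_ge0 ?(ltW S0) // excess_ge0.
exact: excess_cross_le fM fC drho fsigma dr0 fs0 S1.
Qed.
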